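(* Let $\Omega \subset \mathbb{R}^2$ be a bounded, convex domain. Then there exists $c_{\Omega}$ such that, as $L \rightarrow \infty$, the set $$ S = \Omega \cap S_{L^{1/3}, L^{-2/3}} $$ (that is, $\Omega \cap S_{n,\varepsilon}$ with $n = L^{1/3}$ and $\varepsilon = L^{-2/3}$) has length $\mathcal{H}^1(S) \sim L$ and $$ \left\| \#(\ell \cap S) - \frac{2}{\pi}\frac{L}{\mathrm{area}(\Omega)} \mathcal{H}^1(\ell \cap \Omega) \right\|_{L^{\infty}(\mu)} \leq c_{\Omega} \cdot L^{1/3}, $$ where $\ell$ ranges over all lines in $\mathbb{R}^2$ and $\mu$ is the kinematic measure on lines.
   Context: The Steinhaus set $S_{n,\varepsilon} \subset \mathbb{R}^2$ denotes $n$ lines going through the origin at an equal angle together with all translates by $\varepsilon$: $$ S_{n,\varepsilon} = \left\{ \begin{pmatrix} \cos(\pi k/n) \\ \sin(\pi k/n) \end{pmatrix} t + \begin{pmatrix} -\sin(\pi k/n) \\ \cos(\pi k/n) \end{pmatrix} s\varepsilon : \ t \in \mathbb{R},\ s \in \mathbb{Z},\ 0 \leq k < n \right\}, $$ where $k$ runs over integers. $\mathcal{H}^1$ denotes one-dimensional Hausdorff measure (length), $\mathrm{area}$ is Lebesgue measure on $\mathbb{R}^2$, and $\#(\ell \cap S)$ is the number of points of $\ell \cap S$ (possibly $\infty$). The symbol $\sim$ means ''of the same order as'', with implicit constants allowed to depend on $\Omega$. The kinematic measure $\mu$ is the measure on the set of lines in $\mathbb{R}^2$, invariant under rotations and translations,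 obtained by parametrizing each line by its direction angle $\theta$ and its signed distance $x$ to the origin and taking the product measure $dx\, d\theta$. For a function $f$ on the set of lines, $\|f\|_{L^\infty(\mu)} = \inf\{ C \geq 0 : |f(\ell)| \leq C \text{ for } \mu\text{-almost every line } \ell \}$; thus sets of lines of $\mu$-measure $0$ (such as the lines containing a segment of $S$) are disregarded.
   Formalization: In the display, L in L/area(Ω) is replaced by the length H^1(S), since the literal display fails by order L unless area(Ω)=1; the literal version is also proved when area(Ω)=1 and n=L^{1/3} exactly. Otherwise n is any integer within 1 of L^{1/3}. *)

(* Defs.v *)
(* MathComp-Analysis; the plane is R * R for an arbitrary R : realType. *)
From HB Require Import structures.
From mathcomp Require Export all_boot all_order all_algebra.
From mathcomp Require Export all_classical all_reals all_analysis.

Set Implicit Arguments.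
Unset Strict Implicit.
Unset Printing Implicit Defensive.

Export Order.TTheory GRing.Theory Num.Theory.
Export numFieldNormedType.Exports.

Local Open Scope classical_set_scope.
Local Open Scope ring_scope.
Local Open Scope ereal_scope.

(* The library norm on R * R is the sup norm, so that Euclidean distances have
   to be written out. *)
Definition edist (R : realType) (p q : R * R) : R :=
  (Num.sqrt ((p.1 - q.1) ^+ 2 + (p.2 - q.2) ^+ 2))%R.

(* maxe gives the empty set diameter 0 instead of ereal_sup set0 = -oo. *)
Definition diam (R : realType) (U : set (R * R)) : \bar R :=
  maxe 0 (ereal_sup [set (edist p q)%:E | p in U & q in U]).

Definition hausdorff1_pre (R : realType) (delta : R) (A : set (R * R)) :
    \bar R :=
  ereal_inf [set \sum_(0 <= i <oo) diam (U i) | U in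
    [set U : (set (R * R))^nat |
      A `<=` \bigcup_i U i /\ forall i, diam (U i) <= delta%:E]].

Definition hausdorff1 (R : realType) (A : set (R * R)) : \bar R :=
  ereal_sup [set hausdorff1_pre delta A | delta in [set d : R | (0 < d)%R]].

Definition area (R : realType) (A : set (R * R)) : \bar R :=
  (@lebesgue_measure R \x @lebesgue_measure R) A.

Definition line (R : realType) (theta x : R) : set (R * R) :=
  [set ((cos theta * t - sin theta * x)%R, (sin theta * t + cos theta * x)%R)
    | t in [set: R]].

Definition steinhaus (R : realType) (n : nat) (eps : R) : set (R * R) :=
  [set p | exists (k : nat) (s : int),
     (k < n)%N /\ line (pi * k%:R / n%:R) (s%:~R * eps) p].

(* d theta dx on [0, pi[ * R: (theta, x) |-> line theta x is a bijection from
   this set onto the unoriented lines of the plane. *)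
Definition kinematic (R : realType) :=
  mrestr (@lebesgue_measure R) (measurable_itv `[0%R, pi[) \x
  @lebesgue_measure R.

Definition Linfty_lines (R : realType) (f : set (R * R) -> \bar R) : \bar R :=
  'N[@kinematic R]_+oo[(fun p => f (line p.1 p.2))].

(* Main.v *)
Require Import Defs.
From mathcomp Require Import finmap measurable_realfun ring lra zify.

Set Implicit Arguments.
Unset Strict Implicit.
Unset Printing Implicit Defensive.

Local Open Scope classical_set_scope.
Local Open Scope ring_scope.

(** Let y = L^(1/3), so that n is within 1 of y and e = y^-2 is the spacing of
    the parallel lines.  A line l that cuts Omega in a segment of length b - a
    and makes the angle phi_k with the k-th direction meets the lines of that
    direction at points whose offsets fill an interval of length
    (b - a) |sin phi_k|.  An interval of length c contains c / e multiples of e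
    up to an error of 1 ([spans_count]), so the n directions together give
    (b - a) / e * sum_k |sin phi_k| crossings up to an error of n
    ([crossing_count]).  The angles phi_k are equally spaced, and their sum of
    |sin| has a closed form that differs from 2 n / pi by O(1 / n) only
    ([sum_abs_sin_approx]); this changes the count by O(1 / (n e)).  The choice
    n = y, e = y^-2 balances the two errors: n and 1 / (n e) are both of the
    order of y.

    It remains to see that the density n / e is H^1(S) / area(Omega) up to O(n).
    The length of S is the sum of the lengths of its chords, because two
    distinct lines share at most one point ([hausdorff1_chords]).  The chords
    of one direction have total length area(Omega) / e + O(1)
    ([sum_chords_area]): projected on a coordinate axis, they cover a point X
    as often as the slice of Omega above X contains points of a grid, so that
    counting grid points in intervals and integrating over X gives the area by
    Fubini's theorem.

    The count of crossings may fail for lines that are parallel to one of the n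
    directions or pass through a point where two lines of S cross; these lines
    form a set of kinematic measure 0 ([ae_angle_neq], [ae_line_misses_meet]). *)

(** * Equispaced sums of |sin| *)

Section trig.
Variable R : realType.
Implicit Types x u th : R.

Lemma sin_mvt x : 0 <= x -> exists2 c, 0 <= c <= x & sin x = cos c * x.
Proof.
move=> x0.
have [|c cx] := @MVT_segment R sin cos 0 x x0.
  by apply: continuous_subspaceT => y; exact: continuous_sin.
by rewrite sin0 !subr0 => ->; exists c => //; move: cx; rewrite in_itv.
Qed.

Lemma sin_le_id x : 0 <= x -> sin x <= x.
Proof.
move=> x0; have [c _ ->] := sin_mvt x0.
by rewrite ler_piMl// cos_le1.
Qed.

Lemma mul_cos_le_sin x : 0 <= x <= pi -> x * cos x <= sin x.
Proof.
move=> /andP[x0 xpi]; have [c /andP[c0 cx] ->] := sin_mvt x0.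
rewrite mulrC ler_wpM2r// leNgt ltr_cos ?in_itv/= ?c0 ?x0 ?xpi ?(le_trans cx)//.
by rewrite -leNgt.
Qed.

Lemma cos_ge_parabola x : 1 - x ^+ 2 / 2 <= cos x.
Proof.
wlog x0 : x / 0 <= x.
  move=> H; have [/H//|x0] := leP 0 x.
  by rewrite -cosN -sqrrN; apply: H; rewrite oppr_ge0 ltW.
have y0 : 0 <= x / 2 by rewrite divr_ge0.
have -> : x = x / 2 *+ 2 by rewrite -mulr_natr divfK.
move: (x / 2) y0 => y y0.
rewrite cos_mulr2n cos2sin2.
have [c _ sy] := sin_mvt y0.
have : sin y ^+ 2 <= y ^+ 2.
  by rewrite sy exprMn ler_piMl ?sqr_ge0.
by move=> sq; rewrite (_ : y *+ 2 = 2 * y) ?mulr_natl//; nra.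
Qed.

Lemma exists_floor_lt (n : nat) (y : R) : 0 <= y < n%:R ->
  exists2 j : nat, (j < n)%N & j%:R <= y < j.+1%:R.
Proof.
elim: n => [|n IH] /andP[y0 yn]; first by move: (le_lt_trans y0 yn); rewrite ltxx.
have [ny|yn'] := leP n%:R y; first by exists n => //; rewrite ny.
have [|j jn jy] := IH; first by rewrite y0.
by exists j => //; exact: ltnW.
Qed.

(** Multiplication by [2 * sin u] turns each term into a difference of two
    consecutive values of one cosine [C].  The sign of the sine changes once, so
    there are two telescoping sums; they meet at [C j.+1], and their outer ends
    [C 0] and [C n] cancel because their arguments differ by [pi]. *)
Lemma sum_abs_sin (n : nat) th (u := pi / n%:R / 2 : R) : (0 < n)%N ->
  0 <= th < pi ->
  exists2 v, - u <= v <= u &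
    (\sum_(k < n) `|sin (th - pi * k%:R / n%:R)|) * sin u = cos v.
Proof.
move=> n0 /andP[th0 thpi].
have n0R : 0 < n%:R :> R by rewrite ltr0n.
have u0 : 0 < u by rewrite !divr_gt0// pi_gt0.
have piE : pi = 2 * u * n%:R by rewrite /u; field; rewrite gt_eqF.
have thetaE k : pi * k%:R / n%:R = 2 * u * k%:R.
  by rewrite {1}piE; field; rewrite gt_eqF.
have u2 : 0 < 2 * u by rewrite mulr_gt0.
clearbody u.
have [|j jn /andP[j1 j2]] := @exists_floor_lt n (th / (2 * u)).
  apply/andP; split; first by rewrite divr_ge0// ltW.
  by rewrite ltr_pdivrMr// mulrC -piE.
rewrite ler_pdivlMr// in j1.
rewrite ltr_pdivrMr// in j2.
pose C k := cos (th - u * (2 * k%:R - 1)).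
have CS k : 2 * sin (th - 2 * u * k%:R) * sin u = C k.+1 - C k.
  rewrite /C.
  rewrite (_ : th - u * (2 * k.+1%:R - 1) = (th - 2 * u * k%:R) - u); last by rewrite -(natr1 k); ring.
  rewrite (_ : th - u * (2 * k%:R - 1) = (th - 2 * u * k%:R) + u); last by ring.
  by move: (th - 2 * u * k%:R) => a; rewrite cosB cosD; ring.
exists (th - u * (2 * j.+1%:R - 1)).
  by rewrite -(natr1 j) in j2 *; apply/andP; split; lra.
under eq_bigr do rewrite thetaE.
rewrite -[cos _]/(C j.+1).
suff : \sum_(k < n) 2 * `|sin (th - 2 * u * k%:R)| * sin u = C j.+1 *+ 2.
  rewrite -mulr_suml -mulr_sumr -mulr_natr mulrC; nra.
rewrite -(big_mkord xpredT (fun k => 2 * `|sin (th - 2 * u * k%:R)| * sin u)).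
have su (k : nat) : (k < n)%N -> 0 <= 2 * u * k%:R < pi.
  move=> kn; apply/andP; split; first by rewrite mulr_ge0// ltW.
  by rewrite piE ltr_pM2l// ltr_nat.
rewrite (big_cat_nat (n := j.+1))//=.
have -> : \sum_(0 <= k < j.+1) 2 * `|sin (th - 2 * u * k%:R)| * sin u
        = C j.+1 - C 0%N.
  rewrite -telescope_sumr//; apply: eq_big_nat => k /andP[_ kj].
  rewrite -CS ger0_norm// sin_ge0_pi//.
  have kj' : k%:R <= j%:R :> R by rewrite ler_nat.
  have := su k (leq_trans kj jn); move=> /andP[s1 s2].
  have : 2 * u * k%:R <= 2 * u * j%:R by rewrite ler_pM2l.
  by move=> ?; apply/andP; split; lra.
have -> : \sum_(j.+1 <= k < n) 2 * `|sin (th - 2 * u * k%:R)| * sin u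
        = - (C n - C j.+1).
  rewrite -telescope_sumr// -sumrN; apply: eq_big_nat => k /andP[jk kn].
  rewrite -CS ler0_norm; first by ring.
  rewrite -oppr_ge0 -sinN sin_ge0_pi//.
  have kj' : j.+1%:R <= k%:R :> R by rewrite ler_nat.
  have := su k kn; move=> /andP[s1 s2].
  have : 2 * u * j.+1%:R <= 2 * u * k%:R by rewrite ler_pM2l.
  by move=> ?; apply/andP; split; lra.
have -> : C n = - C 0%N.
  rewrite /C (_ : th - u * (2 * n%:R - 1) = th + u - pi); last by rewrite piE; ring.
  rewrite (_ : th - u * (2 * 0%:R - 1) = th + u); last by ring.
  by move: (th + u) => a; rewrite cosB cospi sinpi; ring.
by rewrite -mulr_natr; ring.
Qed.

(** Both [cos v] and [u / sin u] are [1 + O(u ^ 2)], so the sum is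
    [u^-1 + O(u)] with [u = pi / (2 * n)].  Estimating it as a Riemann sum of a
    function of bounded variation would leave an error [O(1)], which is too
    large by a factor [n]. *)
Lemma sum_abs_sin_approx (n : nat) th : (1 < n)%N -> 0 <= th < pi ->
  `|\sum_(k < n) `|sin (th - pi * k%:R / n%:R)| - 2 / pi * n%:R| <= 2 / n%:R.
Proof.
move=> n1 thpi; have n0 : (0 < n)%N := ltnW n1.
have n0R : 0 < n%:R :> R by rewrite ltr0n.
have [v /andP[v1 v2]] := sum_abs_sin n0 thpi.
set S := \sum_(k < n) _; set u := pi / n%:R / 2 in v1 v2 * => SE.
have pi4 : pi <= 4 :> R by have := @pihalf_lt2 R; lra.
have u0 : 0 < u by rewrite !divr_gt0// pi_gt0.
have u1 : u <= 1.
  rewrite /u ler_pdivrMr// ler_pdivrMr//.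
  have : 2 <= n%:R :> R by rewrite ler_nat.
  by lra.
have upi : u <= pi by have := @pi_ge2 R; lra.
have un : u <= 2 / n%:R.
  by rewrite /u ler_pdivrMr// mulrAC ler_wpM2r ?invr_ge0//; lra.
have -> : 2 / pi * n%:R = u^-1.
  have pi0 : pi != 0 :> R by rewrite gt_eqF// pi_gt0.
  have nn0 : n%:R != 0 :> R by rewrite gt_eqF.
  by rewrite /u; move: (pi : R) pi0 nn0 => p p0 nn0; field; rewrite p0 nn0.
have sin1 := sin_le_id (ltW u0).
have sin2 : u * (1 - u ^+ 2 / 2) <= sin u.
  apply: (le_trans _ (mul_cos_le_sin _)); last by rewrite (ltW u0).
  by rewrite ler_wpM2l ?(ltW u0)// cos_ge_parabola.
have cv2 := cos_le1 v.
have v2u : v ^+ 2 <= u ^+ 2 by nra.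
have cv1 : 1 - u ^+ 2 / 2 <= cos v by apply: (le_trans _ (cos_ge_parabola v)); lra.
have sin0 : 0 < sin u by apply: lt_le_trans sin2; nra.
suff : `|S - u^-1| <= u by move=> /le_trans; apply.
rewrite ler_distl.
have SE' : S = cos v / sin u by rewrite -SE mulfK// gt_eqF.
apply/andP; split.
- rewrite SE' ler_pdivlMr//.
  have : (u^-1 - u) * sin u <= (u^-1 - u) * u.
    by rewrite ler_wpM2l// subr_ge0 (le_trans u1)// -[leLHS]invr1 lef_pV2 ?posrE.
  have -> : (u^-1 - u) * u = 1 - u ^+ 2 by rewrite mulrBl mulVf// gt_eqF.
  by move=> H; apply: (le_trans H); apply: le_trans cv1; have := sqr_ge0 u; lra.
- rewrite SE' ler_pdivrMr//.
  have : (u^-1 + u) * (u * (1 - u ^+ 2 / 2)) <= (u^-1 + u) * sin u.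
    by rewrite ler_wpM2l// addr_ge0 ?invr_ge0// ltW.
  have -> : (u^-1 + u) * (u * (1 - u ^+ 2 / 2)) = 1 + u ^+ 2 / 2 * (1 - u ^+ 2).
    by field; rewrite gt_eqF.
  move=> H; apply: le_trans H; apply: (le_trans cv2).
  by rewrite lerDl mulr_ge0// ?divr_ge0 ?sqr_ge0// subr_ge0; nra.
Qed.

End trig.

(** * Intervals and the grid points in them *)

Section intervals.
Variable R : realType.
Implicit Types (J : set R) (a b c u B e : R).

(** [J] is an interval whose end points may or may not belong to it.  The empty
    set spans [a, a] for every [a], so that empty chords need no special
    case. *)
Definition spans a b J := [/\ a <= b, `]a, b[ `<=` J & J `<=` `[a, b]].

Lemma spans_is_interval a b J : spans a b J -> is_interval J.
Proof.
move=> [ab J1 J2] x y Jx Jy z /andP[xz zy].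
move: (J2 _ Jx) (J2 _ Jy); rewrite /= !in_itv/= => /andP[ax _] /andP[_ yb].
move: xz zy; rewrite le_eqVlt => /orP[/eqP<-//|xz].
rewrite le_eqVlt => /orP[/eqP->//|zy].
by apply: J1; rewrite /= in_itv/= (le_lt_trans ax)// (lt_le_trans zy).
Qed.

Lemma spans_measurable a b J : spans a b J -> measurable J.
Proof. by move=> /spans_is_interval; exact: is_interval_measurable. Qed.

Lemma spans_measure a b J : spans a b J -> lebesgue_measure J = (b - a)%:E.
Proof.
move=> sJ; have mJ := spans_measurable sJ; move: sJ => [ab J1 J2].
have io : lebesgue_measure (`]a, b[ : set R) = (b - a)%:E.
  rewrite lebesgue_measure_itv/= lte_fin; case: ltP => // ba.
  by rewrite (le_anti (x := a) (y := b)) ?ab// subrr.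
have ic : lebesgue_measure (`[a, b] : set R) = (b - a)%:E.
  rewrite lebesgue_measure_itv/= lte_fin; case: ltP => // ba.
  by rewrite (le_anti (x := a) (y := b)) ?ab// subrr.
apply/eqP; rewrite eq_le -{1}ic -io; apply/andP; split.
- by apply: le_measure; [exact: (mem_set mJ)|exact: (mem_set (measurable_itv _))|exact: J2].
- by apply: le_measure; [exact: (mem_set (measurable_itv _))|exact: (mem_set mJ)|exact: J1].
Qed.

Lemma is_interval_spans B J : 0 <= B -> is_interval J ->
  (forall x, J x -> `|x| <= B) ->
  exists a b, [/\ - B <= a, b <= B & spans a b J].
Proof.
move=> B0 iJ JB; have [->|/set0P[x0 Jx0]] := eqVneq J set0.
  exists 0, 0; split => //; first by rewrite oppr_le0.
  split => // x; rewrite /= in_itv/= => /andP[x1 x2].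
  by move: (lt_trans x1 x2); rewrite ltxx.
have JN : J !=set0 by exists x0.
have Jl : has_lbound J.
  by exists (- B) => x /JB; rewrite ler_norml => /andP[].
have Ju : has_ubound J.
  by exists B => x /JB; rewrite ler_norml => /andP[].
have Ji : J `<=` `[inf J, sup J].
  move=> x Jx; rewrite /= in_itv/=; apply/andP; split.
    exact: ge_inf.
  exact: ub_le_sup.
exists (inf J), (sup J); split.
- by apply: lb_le_inf => // x /JB; rewrite ler_norml => /andP[].
- by apply: ge_sup => // x /JB; rewrite ler_norml => /andP[].
split=> //.
  by move: (Ji _ Jx0); rewrite /= in_itv/= => /andP[]; exact: le_trans.
move=> x; rewrite /= in_itv/= => xJ; apply: interior_subset.
by rewrite interval_bounded_interior.
Qed.

Lemma spans_affine a b J u c : u != 0 -> spans a b J ->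
  exists a' b', spans a' b' [set t | J (u * t + c)] /\ b' - a' = (b - a) / `|u|.
Proof.
move=> u0 [ab J1 J2].
have [up|un] : 0 < u \/ u < 0 by move: u0; rewrite neq_lt => /orP[]; auto.
- exists ((a - c) / u), ((b - c) / u); split; last first.
    by rewrite gtr0_norm// -mulrBl; congr (_ / _); ring.
  split.
  + by rewrite ler_pM2r ?invr_gt0//; lra.
  + move=> t; rewrite /= in_itv/= ltr_pdivrMr// ltr_pdivlMr// => /andP[t1 t2].
    by apply: J1; rewrite /= in_itv/=; apply/andP; split; lra.
  + move=> t /J2; rewrite /= !in_itv/= ler_pdivrMr// ler_pdivlMr// => /andP[t1 t2].
    by apply/andP; split; lra.
- exists ((b - c) / u), ((a - c) / u); split; last first.
    by rewrite ltr0_norm// -mulrBl invrN mulrN -mulNr; congr (_ / _); ring.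
  split.
  + by rewrite ler_nM2r ?invr_lt0//; lra.
  + move=> t; rewrite /= in_itv/= ltr_ndivrMr// ltr_ndivlMr// => /andP[t1 t2].
    by apply: J1; rewrite /= in_itv/=; apply/andP; split; lra.
  + move=> t /J2; rewrite /= !in_itv/= ler_ndivrMr// ler_ndivlMr// => /andP[t1 t2].
    by apply/andP; split; lra.
Qed.

Lemma sum_lt_ge (N : nat) (x : R) : x <= N%:R ->
  x <= \sum_(i < N) ((i%:R < x)%R : nat)%:R.
Proof.
elim: N => [|N IH] xN; first by rewrite big_ord0.
rewrite big_ord_recr/=; have [/IH xN'|Nx] := leP x N%:R; first by rewrite addr0.
apply: (le_trans xN).
rewrite -(natr1 N) lerD2r (eq_bigr (fun=> 1)).
  by rewrite sumr_const card_ord.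
by move=> i _; rewrite (lt_trans _ Nx)// ltr_nat.
Qed.

Lemma sum_le_le (N : nat) (x : R) : 0 <= x ->
  \sum_(i < N) ((i%:R <= x)%R : nat)%:R <= x + 1.
Proof.
move=> x0; elim: N => [|N IH]; first by rewrite big_ord0; lra.
rewrite big_ord_recr/=; have [Nx|Nx] := leP N%:R x; last by rewrite addr0.
rewrite lerD2r (le_trans _ Nx)//.
have -> : N%:R = \sum_(i < N) 1 :> R by rewrite sumr_const card_ord.
by apply: ler_sum => i _; rewrite lern1 leq_b1.
Qed.

(** Indexing the multiples of [e] by [i < K.*2.+1] restricts them to the finite
    range from [- K * e] to [K * e]. *)
Definition slot (K : nat) e (i : nat) := (i%:R - K%:R) * e.

(** In units of [e] and shifted by [K], the end points become [A <= C], between 0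
    and [K.*2.+1].  The count is at least the number of naturals below [C] minus
    those up to [A], which is at least [C - A - 1], and at most the number of
    those up to [C] minus those below [A], which is at most [C - A + 1]. *)
Lemma spans_count a b J e B (K : nat) : 0 < e -> spans a b J ->
  - B <= a -> b <= B -> B <= K%:R * e ->
  `|\sum_(i < K.*2.+1) \1_J (slot K e i) - (b - a) / e| <= 1.
Proof.
move=> e0 [ab J1 J2] Ba bB BK.
have ae (x : R) : (x / e + K%:R = (x + K%:R * e) / e) by field; rewrite gt_eqF.
set A := a / e + K%:R; set C := b / e + K%:R.
have A0 : 0 <= A by rewrite /A ae divr_ge0 ?(ltW e0)//; lra.
have AC : A <= C by rewrite /A /C lerD2r ler_pM2r ?invr_gt0.
have CN : C <= K.*2.+1%:R.
  rewrite /C ae ler_pdivrMr// -(natr1 K.*2) -addnn natrD; lra.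
have lt1 (i : nat) : (i%:R < C) = (slot K e i < b).
  by rewrite /C ae ltr_pdivlMr// /slot mulrBl ltrBlDr.
have lt2 (i : nat) : (i%:R < A) = (slot K e i < a).
  by rewrite /A ae ltr_pdivlMr// /slot mulrBl ltrBlDr.
have le1 (i : nat) : (i%:R <= C) = (slot K e i <= b).
  by rewrite /C ae ler_pdivlMr// /slot mulrBl lerBlDr.
have le2 (i : nat) : (i%:R <= A) = (slot K e i <= a).
  by rewrite /A ae ler_pdivlMr// /slot mulrBl lerBlDr.
have -> : (b - a) / e = C - A by rewrite /A /C mulrBl; ring.
have s1 := sum_lt_ge CN.
have s2 := sum_lt_ge (le_trans AC CN).
have s3 := sum_le_le K.*2.+1 A0.
have s4 := sum_le_le K.*2.+1 (le_trans A0 AC).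
have low : \sum_(i < K.*2.+1) ((i%:R < C)%R : nat)%:R
   - \sum_(i < K.*2.+1) ((i%:R <= A)%R : nat)%:R
   <= \sum_(i < K.*2.+1) \1_J (slot K e i) :> R.
  rewrite lerBlDr -big_split/=; apply: ler_sum => i _; rewrite lt1 le2 indicE.
  case: ltP => ib; last by rewrite addr_ge0.
  case: (leP (slot K e i) a) => ia; first by rewrite lerDr.
  by rewrite mem_set ?addr0//; apply: J1; rewrite /= in_itv/= ia.
have up : \sum_(i < K.*2.+1) \1_J (slot K e i) <=
  \sum_(i < K.*2.+1) ((i%:R <= C)%R : nat)%:R
   - \sum_(i < K.*2.+1) ((i%:R < A)%R : nat)%:R :> R.
  rewrite lerBrDr -big_split/=; apply: ler_sum => i _; rewrite lt2 le1 indicE.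
  have [/set_mem/J2|nJ] := boolP (slot K e i \in J).
    by rewrite /= in_itv/= => /andP[ia ->]; rewrite ltNge ia/= addr0.
  case: (leP (slot K e i) b) => ib; case: (ltP (slot K e i) a) => ia /=; rewrite ?add0r ?addr0//.
  by lra.
by rewrite ler_distl; apply/andP; split; lra.
Qed.

End intervals.

(** * Length of a finite union of chords *)

Section finite_families.
Variables (T : Type) (R : realType) (J : finType) (B : J -> set T).

(** Covers and sigma-subadditivity are stated for sequences of sets; a finite
    family becomes one by appending empty sets. *)
Definition enum_seq (n : nat) : set T :=
  if insub n is Some i then B (@enum_val J predT i) else set0.

Lemma bigcup_enum_seq : \bigcup_n enum_seq n = \bigcup_j B j.
Proof.
apply/seteqP; split => [t [n _]|t [j _ Bjt]].
  by rewrite /enum_seq; case: insubP => // i _ _ Bt; exists (enum_val i).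
exists (enum_rank j) => //; rewrite /enum_seq.
case: insubP => [i _ ij|]; last by rewrite ltn_ord.
by rewrite (_ : i = enum_rank j) ?enum_rankK//; exact: val_inj.
Qed.

Lemma nneseries_enum_seq (f : set T -> \bar R) : f set0 = 0%E ->
  (forall A, 0 <= f A)%E ->
  (\sum_(0 <= n <oo) f (enum_seq n) = \sum_(j : J) f (B j))%E.
Proof.
move=> f0 fge0; rewrite (@nneseries_split _ _ 0 #|J|)//.
rewrite [X in (_ + X)%E]eseries0 ?adde0; last first.
  move=> i Ji _; rewrite /enum_seq; case: insubP => // o.
  by rewrite ltnNge Ji.
rewrite add0n big_mkord.
rewrite [RHS](big_enum_val (A := predT) (fun j => f (B j)))/=.
apply: eq_bigr => i _; rewrite /enum_seq; case: insubP => [j _ ij|].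
  by rewrite (_ : j = i)//; exact: val_inj.
by rewrite ltn_ord.
Qed.

End finite_families.

Section hausdorff.
Variable R : realType.
Implicit Types (p q : R * R) (U A : set (R * R)) (t th x : R).

Definition line_point th x t : R * R :=
  (cos th * t - sin th * x, sin th * t + cos th * x).

(** Signed distance from [p] to [line th x]. *)
Definition offset th x p : R := cos th * p.2 - sin th * p.1 - x.

Lemma edist_line_point th x s t : edist (line_point th x s) (line_point th x t) = `|s - t|.
Proof.
rewrite /edist /line_point /= -sqrtr_sqr; congr Num.sqrt.
have := cos2Dsin2 th; move: (cos th) (sin th) => c d cd.
transitivity ((c ^+ 2 + d ^+ 2) * (s - t) ^+ 2); first by ring.
by rewrite cd mul1r.
Qed.

Lemma offset_line_point th x th' x' t : offset th' x' (line_point th x t) =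
  sin (th - th') * t + (cos (th - th') * x - x').
Proof. by rewrite /offset /line_point /= sinB cosB; ring. Qed.

(** Cauchy-Schwarz inequality, since [offset] is the scalar product with a unit
    vector up to a constant. *)
Lemma offset_lip th x p q : `|offset th x p - offset th x q| <= edist p q.
Proof.
rewrite /edist -sqrtr_sqr ler_sqrt ?addr_ge0 ?sqr_ge0// /offset.
have := cos2Dsin2 th; move: (cos th) (sin th) => c d cd.
rewrite (_ : _ - _ = c * (p.2 - q.2) - d * (p.1 - q.1)); last by ring.
move: (p.1 - q.1) (p.2 - q.2) => y z; rewrite -subr_ge0.
suff -> : y ^+ 2 + z ^+ 2 - (c * z - d * y) ^+ 2 = (c * y + d * z) ^+ 2.
  exact: sqr_ge0.
transitivity ((c ^+ 2 + d ^+ 2) * (y ^+ 2 + z ^+ 2) - (c * z - d * y) ^+ 2).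
  by rewrite cd mul1r.
by ring.
Qed.

Lemma diam_ge0 U : (0 <= diam U)%E.
Proof. by rewrite /diam le_max lexx. Qed.

Lemma diam0 : diam (set0 : set (R * R)) = 0%E.
Proof.
rewrite /diam [X in ereal_sup X](_ : _ = set0).
  by rewrite ereal_sup0; apply/max_idPl; rewrite leNye.
by apply/seteqP; split => // y [p []].
Qed.

Lemma edist_le_diam U p q : U p -> U q -> ((edist p q)%:E <= diam U)%E.
Proof.
move=> Up Uq; rewrite /diam le_max; apply/orP; right.
by apply: ereal_sup_ubound; exists p => //; exists q.
Qed.

Lemma diam_le U (d : R) : 0 <= d ->
  (forall p q, U p -> U q -> edist p q <= d) -> (diam U <= d%:E)%E.
Proof.
move=> d0 Ud; rewrite /diam ge_max lee_fin d0/=.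
by apply: ge_ereal_sup => _ [p Up [q Uq <-]]; rewrite lee_fin Ud.
Qed.

Lemma hausdorff1_pre_le_finite (d : R) A (J : finType) (V : J -> set (R * R)) :
  0 <= d -> A `<=` \bigcup_j V j -> (forall j, diam (V j) <= d%:E)%E ->
  (hausdorff1_pre d A <= \sum_j diam (V j))%E.
Proof.
move=> d0 AV Vd; rewrite -(@nneseries_enum_seq _ _ _ V (@diam R)).
- apply: ereal_inf_lbound; exists (enum_seq V) => //; split.
    by rewrite bigcup_enum_seq.
  move=> i; rewrite /enum_seq; case: insub => [j|]; first exact: Vd.
  by rewrite diam0 lee_fin.
- exact: diam0.
- exact: diam_ge0.
Qed.

(** Cutting every chord into the same number [M] of equal pieces gives covers by
    sets of arbitrarily small diameter whose diameters add up to the total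
    length of the chords. *)
Lemma hausdorff1_chords_le (I : finType) (th x : I -> R) (T : I -> set R)
    (a b : I -> R) :
  (forall i, spans (a i) (b i) (T i)) ->
  (hausdorff1 (\bigcup_i (line_point (th i) (x i) @` T i)) <=
    (\sum_i (b i - a i))%:E)%E.
Proof.
move=> sT; apply: ge_ereal_sup => _ [d /= d0 <-].
have ab i : 0 <= b i - a i by case: (sT i) => ? _ _; rewrite subr_ge0.
pose tot := \sum_i (b i - a i).
have tot0 : 0 <= tot by apply: sumr_ge0.
pose M := (Num.truncn (tot / d)).+1.
have M0 : 0 < M%:R :> R by rewrite ltr0n.
have totM : tot / M%:R <= d.
  by rewrite ler_pdivrMr// mulrC -ler_pdivrMr// ltW// truncnS_gt.
have lM i : (b i - a i) / M%:R <= d.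
  apply: le_trans totM; rewrite ler_pM2r ?invr_gt0// /tot (bigD1 i)//= lerDl.
  exact: sumr_ge0.
pose h i := (b i - a i) / M%:R.
pose V (j : I * 'I_M) := line_point (th j.1) (x j.1) @`
   `[a j.1 + h j.1 * j.2%:R, a j.1 + h j.1 * j.2.+1%:R].
have h0 i : 0 <= h i by rewrite divr_ge0// ltW.
have dV j : (diam (V j) <= (h j.1)%:E)%E.
  apply: diam_le => // _ _ [s sj <-] [t tj <-]; rewrite edist_line_point.
  move: sj tj; rewrite /= !in_itv/= -(natr1 j.2) mulrDr mulr1.
  move=> /andP[s1 s2] /andP[t1 t2].
  by rewrite ler_norml; apply/andP; split; lra.
apply: (le_trans (hausdorff1_pre_le_finite (V := V) (ltW d0) _ _)).
- move=> _ [i _ [t Tt <-]].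
  have [_ _ /(_ _ Tt)] := sT i; rewrite /= in_itv/= => /andP[at_ tb].
  (* A chord of length 0 lies in its first piece, and the right end point of any
     other chord in its last piece; [exists_floor_lt] finds the remaining
     points. *)
  have [hi|hi] := eqVneq (h i) 0.
    have ba : b i = a i.
      by move/eqP: hi; rewrite /h mulf_eq0 invr_eq0 pnatr_eq0/= orbF subr_eq0 => /eqP.
    exists (i, ord0) => //; exists t => //=.
    by rewrite in_itv/= hi !mul0r addr0 at_ -ba.
  have hp : 0 < h i by rewrite lt0r hi h0.
  have hM : h i * M%:R = b i - a i by rewrite /h divfK// gt_eqF.
  have [tbE|tb'] := eqVneq t (b i).
    exists (i, ord_max) => //; exists t => //=.
    rewrite in_itv/= hM tbE -/M; apply/andP; split; last by lra.
    have : h i * M.-1%:R <= h i * M%:R by rewrite ler_pM2l// ler_nat leq_pred.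
    by rewrite hM /=; lra.
  have [|j jM /andP[j1 j2]] := @exists_floor_lt R M ((t - a i) / h i).
    apply/andP; split; first by rewrite divr_ge0// subr_ge0.
    rewrite ltr_pdivrMr// mulrC hM ltrD2r lt_neqAle tb' tb//.
  exists (i, Ordinal jM) => //; exists t => //=.
  move: j1 j2; rewrite ler_pdivlMr// ltr_pdivrMr// in_itv/= => j1 j2.
  by apply/andP; split; lra.
- by move=> j; apply: (le_trans (dV j)); rewrite lee_fin lM.
apply: (@le_trans _ _ (\sum_(j : I * 'I_M) (h j.1)%:E)%E).
  by apply: lee_sum.
rewrite sumEFin lee_fin.
rewrite -(pair_big xpredT xpredT (fun i (m : 'I_M) => h i))/=.
apply: ler_sum => i _.
rewrite sumr_const card_ord -mulr_natr /h divfK// gt_eqF//.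
Qed.

Lemma measurable_strip (al be d : R) :
  measurable [set t : R | `|al * t + be| <= d].
Proof.
apply: is_interval_measurable => y z /=.
rewrite !ler_norml => /andP[y1 y2] /andP[z1 z2] t /andP[yt tz] /=; rewrite ?ler_norml.
have [al0|al0] := leP 0 al.
  have := ler_wpM2l al0 yt; have := ler_wpM2l al0 tz.
  by move=> ? ?; apply/andP; split; lra.
have := ler_wnM2l (ltW al0) yt; have := ler_wnM2l (ltW al0) tz.
by move=> ? ?; apply/andP; split; lra.
Qed.

(** If [al != 0], the strip is an interval of length [2 * d / |al|]; if [al = 0],
    it is empty as soon as [d < |be|]. *)
Lemma small_strip (al be eta : R) : (al != 0) \/ (be != 0 /\ al = 0) ->
  0 < eta -> \forall d \near (0 : R)^'+,
  (lebesgue_measure [set t : R | (`|al * t + be| <= d)%R] <= eta%:E)%E.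
Proof.
move=> [al0|[be0 ->]] eta0; near=> d.
  have d0 : 0 < d by near: d; exact: nbhs_right_gt.
  have sd : spans (- d) d [set y : R | `|y| <= d].
    split; first by lra.
    - by move=> y; rewrite /= in_itv/= ler_norml => /andP[/ltW-> /ltW->].
    - by move=> y; rewrite /= in_itv/= ler_norml.
  have [a' [b' [sab ab]]] := spans_affine be al0 sd.
  rewrite (_ : [set _ | _] = [set t | [set y : R | `|y| <= d] (al * t + be)])//.
  rewrite (spans_measure sab) ab lee_fin ler_pdivrMr ?normr_gt0//.
  suff : d < eta * `|al| / 2 by lra.
  by near: d; apply: nbhs_right_lt; rewrite divr_gt0// mulr_gt0// normr_gt0.
rewrite [X in lebesgue_measure X](_ : _ = set0) ?measure0 ?lee_fin ?ltW//.
apply/seteqP; split => // t /=; rewrite mul0r add0r; apply/negP; rewrite -ltNge.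
by near: d; apply: nbhs_right_lt; rewrite normr_gt0.
Unshelve. all: by end_near. Qed.

Lemma small_itv_cover (Q : set R) (d : R) :
  (forall s t, Q s -> Q t -> `|s - t| <= d) -> exists c, Q `<=` `[c, c + d].
Proof.
move=> Qd; have [->|/set0P[t0 Qt0]] := eqVneq Q set0; first by exists 0.
have QN : Q !=set0 by exists t0.
have Ql : has_lbound Q.
  exists (t0 - d) => s Qs; have := Qd _ _ Qt0 Qs.
  by rewrite ler_norml => /andP[? ?]; lra.
exists (inf Q) => s Qs; rewrite /= in_itv/=; apply/andP; split; first exact: ge_inf.
rewrite -lerBlDr; apply: lb_le_inf => // t Qt.
by have := Qd _ _ Qs Qt; rewrite ler_norml => /andP[? ?]; lra.
Qed.

Lemma measure_bigcup_fin (J : finType) (B : J -> set R) :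
  (forall j, measurable (B j)) ->
  (lebesgue_measure (\bigcup_j B j) <= \sum_j lebesgue_measure (B j))%E.
Proof.
move=> mB; rewrite -(@nneseries_enum_seq _ _ _ B (@lebesgue_measure R)) ?measure0//.
have mU n : measurable (enum_seq B n).
  by rewrite /enum_seq; case: insub => [j|]; [exact: mB|exact: measurable0].
rewrite -bigcup_enum_seq; apply: measure_sigma_subadditive => //.
exact: bigcupT_measurable.
Qed.

(** Each [U n] meets the line in a set that lies in an interval of length
    [diam (U n)]; the sets that do not meet the part [Q] are not charged, so that
    one cover can be shared out among several chords. *)
Lemma measure_chord_le (th x : R) (Q : set R) (U : nat -> set (R * R)) (d : R) :
  measurable Q -> (forall n, diam (U n) <= d%:E)%E ->
  line_point th x @` Q `<=` \bigcup_n U n ->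
  (lebesgue_measure Q <= \sum_(0 <= n <oo)
    if `[< exists2 t, Q t & U n (line_point th x t) >] then diam (U n) else 0)%E.
Proof.
move=> mQ Ud QU.
have fU n : (diam (U n)) = (fine (diam (U n)))%:E.
  rewrite fineK// ge0_fin_numE ?diam_ge0//.
  by rewrite (le_lt_trans (Ud n))// ltry.
pose P n := exists2 t, Q t & U n (line_point th x t).
have /choice[c cP] n : exists c,
    [set t | U n (line_point th x t)] `<=` `[c, c + fine (diam (U n))].
  apply: small_itv_cover => s t Us Ut.
  by rewrite -lee_fin -fU -(edist_line_point th x); exact: edist_le_diam.
pose F n : set R :=
  if `[< P n >] then `[c n, c n + fine (diam (U n))]%classic else set0.
have mF n : measurable (F n) by rewrite /F; case: ifP.
have QF : Q `<=` \bigcup_n F n.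
  move=> t Qt; have [n _ Un] : (\bigcup_n U n) (line_point th x t) by apply: QU; exists t.
  by exists n => //; rewrite /F; case: asboolP => [_|[]]; [exact: cP|exists t].
apply: (@le_trans _ _ (\sum_(0 <= n <oo) lebesgue_measure (F n))%E).
  exact: measure_sigma_subadditive.
apply: lee_nneseries => // n _; rewrite /F -/(P n); case: ifP => _; last by rewrite measure0.
rewrite lebesgue_measure_itv/= lte_fin ltrDl; case: ifP => _; last exact: diam_ge0.
by rewrite -EFinB (addrC (c n)) addrK -fU.
Qed.

(** A set of the cover can meet several chords, but only near a crossing.  So
    remove from each chord the points at distance at most [d] from another line:
    this costs little length when [d] is small, and a set of diameter at most
    [d] meets at most one of the remaining parts, because [offset] is
    1-Lipschitz. *)
Lemma hausdorff1_chords_ge (I : finType) (th x : I -> R) (T : I -> set R)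
    (a b : I -> R) :
  (forall i, spans (a i) (b i) (T i)) ->
  (forall i j, i != j -> sin (th i - th j) != 0 \/ th i = th j /\ x i != x j) ->
  ((\sum_i (b i - a i))%:E <=
    hausdorff1 (\bigcup_i (line_point (th i) (x i) @` T i)))%E.
Proof.
move=> sT dist; set S := \bigcup_i _.
apply/lee_addgt0Pr => eta eta0.
(* At most #|I| strips are removed from each of the #|I| chords; the 1 only
   makes the denominator positive when I is empty. *)
pose eta' := eta / (#|I|%:R * #|I|%:R + 1).
have den0 : 0 < #|I|%:R * #|I|%:R + 1 :> R by rewrite ltr_wpDl// mulr_ge0.
have eta'0 : 0 < eta' by rewrite divr_gt0.
pose strip (i j : I) (d : R) := [set t : R |
  `|sin (th i - th j) * t + (cos (th i - th j) * x i - x j)| <= d].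
have [d [d0 stripd]] : exists d : R, 0 < d /\ forall ij : I * I, ij.1 != ij.2 ->
    (lebesgue_measure (strip ij.1 ij.2 d) <= eta'%:E)%E.
  have : \forall d \near (0 : R)^'+, forall ij : I * I, ij.1 != ij.2 ->
      (lebesgue_measure (strip ij.1 ij.2 d) <= eta'%:E)%E.
    apply: filter_forall => -[i j]/=; have [->|ij] := eqVneq i j.
      by near=> d => /=.
    have : \forall d \near (0 : R)^'+, (lebesgue_measure (strip i j d) <= eta'%:E)%E.
      apply: small_strip => //; have [sij|[tij xij]] := dist i j ij; first by left.
      by right; rewrite tij subrr cos0 mul1r sin0 subr_eq0.
    by apply: filterS.
  move=> H; have [d [? ?]] := filter_ex (filterI (nbhs_right_gt 0) H).
  by exists d.
apply: (@le_trans _ _ (hausdorff1_pre d S + eta%:E)%E); last first.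
  by apply: leeD2r; apply: ereal_sup_ubound; exists d.
rewrite -leeBlDr//; apply: le_ereal_inf_tmp => _ [U [SU Ud] <-].
pose near_ i := \bigcup_j (if i != j then strip i j d else set0).
have mstrip i j : measurable (if i != j then strip i j d else set0).
  by case: ifP => _; [exact: measurable_strip|exact: measurable0].
have mnear i : measurable (near_ i).
  by apply: fin_bigcup_measurable => [|j _]; [exact: finite_finset|exact: mstrip].
pose Q i := T i `\` near_ i.
have mT i : measurable (T i) := spans_measurable (sT i).
have mQ i : measurable (Q i) by apply: measurableD.
have Tle i : ((b i - a i)%:E <= lebesgue_measure (Q i) + (#|I|%:R * eta')%:E)%E.
  rewrite -(spans_measure (sT i)).
  apply: (@le_trans _ _ (lebesgue_measure (Q i `|` near_ i))).
    apply: le_measure; [exact: (mem_set (mT i))|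
      exact: (mem_set (measurableU _ _ (mQ i) (mnear i)))|].
    by rewrite /Q setDE setUIl setUCl setIT; exact: subsetUl.
  apply: (@le_trans _ _ (lebesgue_measure (Q i) + lebesgue_measure (near_ i))%E).
    by apply: measureU2; [exact: mQ|exact: mnear].
  apply: leeD => //.
  apply: (@le_trans _ _ (\sum_j lebesgue_measure
      (if i != j then strip i j d else set0))%E).
    by apply: measure_bigcup_fin; exact: mstrip.
  apply: (@le_trans _ _ (\sum_(j : I) eta'%:E)%E).
    apply: lee_sum => j _; case: ifP => ij; first exact: (stripd (i, j)).
    by rewrite measure0 lee_fin ltW.
  by rewrite sumEFin lee_fin sumr_const mulr_natl.
pose g i n := (if `[< exists2 t, Q i t & U n (line_point (th i) (x i) t) >]
  then diam (U n) else 0)%E.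
have g0 i n : (0 <= g i n)%E by rewrite /g; case: ifP => // _; exact: diam_ge0.
have Qle i : (lebesgue_measure (Q i) <= \sum_(0 <= n <oo) g i n)%E.
  apply: (measure_chord_le (mQ i) Ud) => _ [t [Tt _] <-].
  by apply: SU; exists i => //; exists t.
rewrite leeBlDr//.
apply: (@le_trans _ _ (\sum_i (lebesgue_measure (Q i) + (#|I|%:R * eta')%:E))%E).
  by rewrite -sumEFin; apply: lee_sum => i _; exact: Tle.
rewrite big_split/=; apply: leeD; last first.
  rewrite sumEFin lee_fin sumr_const -[leLHS]mulr_natl mulrA /eta' mulrA ler_pdivrMr//.
  by rewrite mulrDr mulr1 mulrC lerDl ltW.
apply: (@le_trans _ _ (\sum_i \sum_(0 <= n <oo) g i n)%E).
  by apply: lee_sum => i _; exact: Qle.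
rewrite -nneseries_sum//; apply: lee_nneseries => n _.
  by move=> _; apply: sume_ge0.
have [[i gi]|/forallNP no] := pselect (exists i,
    exists2 t, Q i t & U n (line_point (th i) (x i) t)).
  rewrite (bigD1 i)//= big1 ?adde0; first by rewrite /g asboolT.
  move=> j ji; rewrite /g asboolF// => -[t [Tt nt] Ut].
  move: gi => [s [Ts ns] Us]; apply: nt; exists i => //; rewrite ji /strip/=.
  rewrite -lee_fin; apply: le_trans (Ud n).
  apply: le_trans (edist_le_diam Ut Us); rewrite lee_fin.
  apply: le_trans (offset_lip (th i) (x i) _ _).
  rewrite !offset_line_point subrr sin0 cos0 mul0r mul1r subrr addr0 subr0.
  by rewrite addrA.
rewrite big1 ?diam_ge0// => i _; rewrite /g asboolF//; exact: no.
Unshelve. all: by end_near. Qed.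

Lemma hausdorff1_chords (I : finType) (th x : I -> R) (T : I -> set R)
    (a b : I -> R) :
  (forall i, spans (a i) (b i) (T i)) ->
  (forall i j, i != j -> sin (th i - th j) != 0 \/ th i = th j /\ x i != x j) ->
  hausdorff1 (\bigcup_i (line_point (th i) (x i) @` T i)) = (\sum_i (b i - a i))%:E.
Proof.
move=> sT dist; apply/eqP; rewrite eq_le hausdorff1_chords_le//=.
exact: hausdorff1_chords_ge.
Qed.

Lemma hausdorff1_chord (th x : R) (T : set R) (a b : R) : spans a b T ->
  hausdorff1 (line_point th x @` T) = (b - a)%:E.
Proof.
move=> sT; have := @hausdorff1_chords unit (fun=> th) (fun=> x) (fun=> T)
  (fun=> a) (fun=> b) (fun=> sT).
rewrite bigcup_const; last by exists tt.
rewrite big_const card_unit/= addr0; apply.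
by move=> [] [].
Qed.

End hausdorff.

(** * Total chord length of a family of parallel lines *)

Section plane_sets.
Variable R : realType.
Implicit Types (A : set (R * R)) (p q : R * R).

(** An open set is the union of the countably many open squares contained in it
    that have rational centres and radii of the form [1 / m.+1]. *)
Lemma open_measurable_plane A : open A -> measurable A.
Proof.
move=> oA.
pose box (k : rat * rat * nat) : set (R * R) :=
  `]ratr k.1.1 - k.2.+1%:R^-1, ratr k.1.1 + k.2.+1%:R^-1[%classic `*`
  `]ratr k.1.2 - k.2.+1%:R^-1, ratr k.1.2 + k.2.+1%:R^-1[%classic.
have -> : A = \bigcup_(k in [set k | box k `<=` A]) box k.
  apply/seteqP; split => [[x y] Axy|p [k kA]]; last exact: kA.
  have [/= e e0 eA] : exists2 e : R, 0 < e & ball (x, y) e `<=` A.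
    by move: oA; rewrite openE => /(_ _ Axy) /nbhs_ballP[e /= e0 eA]; exists e.
  have [m [r [rE r0 re]]] : exists m : nat, exists r : R,
      [/\ r = m.+1%:R^-1, 0 < r & 2 * r < e].
    exists (Num.truncn (2 / e)); exists (Num.truncn (2 / e)).+1%:R^-1; split => //.
    by rewrite ltr_pdivrMr ?ltr0n// mulrC -ltr_pdivrMr// truncnS_gt.
  have rat_near (t : R) : exists q : rat, t - r < ratr q < t + r.
    have lt_t : t - r < t + r by lra.
    by have [q qt] := rat_in_itvoo lt_t; exists q; move: qt; rewrite in_itv.
  have [q1 /andP[q11 q12]] := rat_near x.
  have [q2 /andP[q21 q22]] := rat_near y.
  exists (q1, q2, m); rewrite /box /= -rE.
    move=> [x' y'] [] /=; rewrite !in_itv/= => /andP[x1 x2] /andP[y1 y2].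
    by apply: eA; split; rewrite /ball/= ltr_norml; apply/andP; split; lra.
  by split; rewrite /= in_itv/=; apply/andP; split; lra.
rewrite bigcup_mkcond; apply: countable_bigcupT_measurable => // k.
by case: ifP => // _; apply: measurableX.
Qed.

Definition segment_closed A := forall p q (l : R), A p -> A q -> 0 <= l <= 1 ->
  A (l * p.1 + (1 - l) * q.1, l * p.2 + (1 - l) * q.2).

Lemma convex_set_segment_closed A : convex_set (A : set (R^o * R^o)) -> segment_closed A.
Proof.
move=> cA p q l Ap Aq /andP[l0 l1].
have := cA p q (Itv01 l0 l1) (mem_set Ap) (mem_set Aq).
by rewrite in_setE.
Qed.

Lemma bounded_plane A : bounded_set (A : set (R^o * R^o)) ->
  exists2 D : R, 0 < D & forall p, A p -> `|p.1| <= D /\ `|p.2| <= D.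
Proof.
move=> [M [_ /(_ (`|M| + 1))]] AM; exists (`|M| + 1); first by rewrite ltr_wpDl.
move=> p Ap.
have : (`|p : R^o * R^o| <= `|M| + 1)%R.
  by apply: AM => //; rewrite (le_lt_trans (ler_norm _))// ltrDl.
by rewrite prod_normE ge_max => /andP[].
Qed.

Lemma segment_closed_slice A p q : segment_closed A ->
  is_interval [set t : R | A (p.1 + t * q.1, p.2 + t * q.2)].
Proof.
move=> cA x y /= Ax Ay t /andP[xt ty].
have [xy|xy] := eqVneq x y.
  by rewrite (_ : t = x)//; apply/le_anti; rewrite xt xy ty.
have yx : 0 < y - x by rewrite subr_gt0 lt_neqAle xy (le_trans xt).
pose l := (y - t) / (y - x).
have l01 : 0 <= l <= 1.
  apply/andP; split; first by apply: divr_ge0; lra.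
  by rewrite ler_pdivrMr//; lra.
have := cA _ _ l Ax Ay l01; rewrite /=.
have tE : t = l * x + (1 - l) * y by rewrite /l; field; rewrite gt_eqF.
clearbody l; move=> Al /=.
have E c d : c + t * d = l * (c + x * d) + (1 - l) * (c + y * d).
  by rewrite tE; ring.
by rewrite !E.
Qed.

Definition swap_set A : set (R * R) := [set p | A (p.2, p.1)].

Lemma area_swap A : measurable A -> area (swap_set A) = area A.
Proof.
move=> mA; rewrite /area.
have := @indic_fubini_tonelli _ _ _ _ R lebesgue_measure lebesgue_measure A mA.
rewrite [X in X = _](_ : _ = (lebesgue_measure \x lebesgue_measure)%E A); last first.
  by congr integral; exact: (indic_fubini_tonelli_FE lebesgue_measure mA).
move=> ->.
transitivity (\int[lebesgue_measure]_x (lebesgue_measure \o ysection A) x)%E; last first.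
  by congr integral; apply/esym; exact: (indic_fubini_tonelli_GE lebesgue_measure mA).
apply: eq_integral => x _ /=; congr (lebesgue_measure _).
Qed.

End plane_sets.

Section chord_sums.
Variable R : realType.
Implicit Types (A : set (R * R)).

(** The lines have direction [(u, w)] and normal [(- s * w, s * u)]; the sign [s]
    makes the statement stable under the exchange of the two coordinates.
    Projection on the first axis multiplies the lengths of chords by [|u|].
    The number [N X] of chords that pass over a point [X] of this axis is the
    number of grid points in an affine image, of length [|u| * len X], of the
    slice of [A] over [X].  Hence [N X] is [|u| / e * len X] up to an error of 1
    when [|X| <= D], and both vanish otherwise.  Integration over [X] gives the
    result. *)
Lemma sum_chords_project A (D e u w s : R) (K : nat) (a b : nat -> R) :
  measurable A -> segment_closed A -> 0 <= D ->
  (forall p, A p -> `|p.1| <= D /\ `|p.2| <= D) ->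
  0 < e -> 2 * D <= K%:R * e ->
  u ^+ 2 + w ^+ 2 = 1 -> s ^+ 2 = 1 -> u != 0 ->
  (forall i : nat, spans (a i) (b i)
    [set t | A (u * t - s * w * slot K e i, w * t + s * u * slot K e i)]) ->
  exists2 al : R, area A = al%:E &
    `|\sum_(i < K.*2.+1) (b i - a i) - al / e| <= 2 * D / `|u|.
Proof.
move=> mA cA D0 AD e0 DK uw s2 u0 sT.
have nu0 : 0 < `|u| by rewrite normr_gt0.
pose Y (x X : R) := w / u * X + s / u * x.
have YE x t : Y x (u * t - s * w * x) = w * t + s * u * x.
  rewrite /Y; transitivity (w * t + s / u * x * (1 - w ^+ 2)); first by field.
  by rewrite -uw addrK; field.
pose I i := [set X | A (X, Y (slot K e i) X)].
have iI i : is_interval (I i).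
  have := segment_closed_slice (p := (0, s / u * slot K e i)) (q := (1, w / u)) cA.
  by congr is_interval; apply/seteqP; split => X /=;
    rewrite /I /Y /= mulr1 add0r addrC (mulrC X).
have ID i X : I i X -> `|X| <= D by move=> /AD[].
have /choice[a' /choice[b' sI]] i : exists a' b',
    [/\ - D <= a', b' <= D & spans a' b' (I i)].
  by apply: is_interval_spans => // X; exact: ID.
have lenI i : b' i - a' i = (b i - a i) * `|u|.
  have [_ _ /(spans_affine (- (s * w * slot K e i)) u0)[a2 [b2 [s2' ab2]]]] := sI i.
  have := spans_measure s2'.
  have -> : [set t | I i (u * t + - (s * w * slot K e i))] =
      [set t | A (u * t - s * w * slot K e i, w * t + s * u * slot K e i)].
    by apply/seteqP; split => t /=; rewrite /I /= YE.
  by rewrite (spans_measure (sT i)) ab2 => -[->]; rewrite divfK// gt_eqF.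
pose len X := fine (lebesgue_measure [set y | A (X, y)]).
pose N X := \sum_(i < K.*2.+1) (\1_(I i) X : R).
have lenE X : lebesgue_measure [set y | A (X, y)] = (len X)%:E /\
    `|N X - `|u| / e * len X| <= \1_(`[- D, D]) X.
  have iX : is_interval [set y | A (X, y)].
    have := segment_closed_slice (p := (X, 0)) (q := (0, 1)) cA.
    by congr is_interval; apply/seteqP; split => y /=;
      rewrite mulr0 mulr1 addr0 add0r.
  have [y /AD[]//|c [d [_ _ scd]]] := is_interval_spans D0 iX.
  have lenX : lebesgue_measure [set y | A (X, y)] = (len X)%:E.
    by rewrite /len (spans_measure scd).
  split => //; have lX : len X = d - c by rewrite /len (spans_measure scd).
  rewrite indicE; have [XD|XD] := boolP (X \in _); last first.
    have X0 y : ~ A (X, y).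
      move=> /AD[/= XD' _]; move/negP: XD; apply; rewrite in_setE /= in_itv/=.
      by rewrite -ler_norml.
    rewrite /N big1; last by move=> i _; rewrite indicE memNset//; exact: X0.
    rewrite /len (_ : [set _ | _] = set0) ?measure0/= ?mulr0 ?subrr ?normr0//.
    by apply/seteqP; split => y //= /X0.
  have su0 : s / u != 0.
    by rewrite mulf_neq0 ?invr_eq0// -sqrf_eq0 s2 oner_eq0.
  have nsu : `|s / u| = `|u|^-1.
    rewrite normf_div (_ : `|s| = 1) ?div1r//.
    by apply/eqP; rewrite -sqrp_eq1// -normrX s2 normr1.
  have [a2 [b2 [sJ ab2]]] := spans_affine (w / u * X) su0 scd.
  set J := [set _ | _] in sJ.
  have JE i : I i X = J (slot K e i).
    by rewrite /I /J /Y /= addrC.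
  have iJ : is_interval J.
    have := segment_closed_slice (p := (X, w / u * X)) (q := (0, s / u)) cA.
    by congr is_interval; apply/seteqP; split => y /=;
      rewrite /J/= mulr0 addr0 addrC (mulrC y).
  have JD x : J x -> `|x| <= 2 * D.
    move=> Jx.
    have {Jx} : A (X, Y x X) by move: Jx; rewrite /J /Y/= addrC.
    move=> /AD/= [X1 Y1].
    have -> : x = s * (u * Y x X - w * X).
      rewrite /Y; transitivity (s ^+ 2 * x); first by rewrite s2 mul1r.
      by field.
    have s1 : `|s| = 1 by apply/eqP; rewrite -sqrp_eq1// -normrX s2 normr1.
    rewrite normrM s1 mul1r (le_trans (ler_normB _ _))// !normrM.
    have u1 : `|u| <= 1.
      by rewrite ler_norml; have := sqr_ge0 w => w2; apply/andP; split; nra.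
    have w1 : `|w| <= 1.
      by rewrite ler_norml; have := sqr_ge0 u => u2; apply/andP; split; nra.
    have := ler_pM (normr_ge0 u) (normr_ge0 (Y x X)) u1 Y1.
    have := ler_pM (normr_ge0 w) (normr_ge0 X) w1 X1.
    by lra.
  have [|a3 [b3 [a3D b3D sJ3]]] := is_interval_spans _ iJ JD; first by rewrite mulr_ge0.
  have ab3 : b3 - a3 = len X * `|u|.
    have := spans_measure sJ3; rewrite (spans_measure sJ) => -[<-].
    by rewrite ab2 lX nsu invrK.
  have := spans_count e0 sJ3 a3D b3D DK.
  rewrite ab3 (_ : len X * `|u| / e = `|u| / e * len X); last by ring.
  suff -> : N X = \sum_(i < K.*2.+1) \1_J (slot K e i) by [].
  apply: eq_bigr => i _; rewrite !indicE.
  rewrite (_ : (X \in I i) = (slot K e i \in J))//.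
  by apply/idP/idP => /set_mem IX; apply/mem_set; move: IX; rewrite JE.
pose mu := @lebesgue_measure R.
have mI i : measurable (I i) by have [_ _ /spans_measurable] := sI i.
have mD : measurable (`[- D, D] : set R) by [].
have m1 (J : set R) : measurable J -> measurable_fun [set: R] (EFin \o (\1_J : R -> R)).
  by move=> mJ; apply/measurable_EFinP; exact: measurable_indic.
have mN : measurable_fun [set: R] (EFin \o N).
  rewrite (_ : EFin \o N = fun X => (\sum_(i < K.*2.+1) (\1_(I i) X)%:E)%E).
    by apply: emeasurable_sum => i; exact: m1.
  by apply/funext => X; rewrite /N /= sumEFin.
have mlen : measurable_fun [set: R] (EFin \o len).
  have := measurable_fun_xsection mu mA.
  congr (measurable_fun setT _); apply/funext => X /=.
  by rewrite -(lenE X).1; congr (lebesgue_measure _); apply/seteqP; split => y;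
    rewrite /xsection/= in_setE.
have len0 X : 0 <= len X by rewrite /len fine_ge0.
have N0 X : 0 <= N X by apply: sumr_ge0 => i _; rewrite indicE.
have areaE : area A = (\int[mu]_X (len X)%:E)%E.
  apply: eq_integral => X _ /=; rewrite -(lenE X).1.
  by congr (lebesgue_measure _); apply/seteqP; split => y; rewrite /xsection/= in_setE.
have intI (J : set R) : measurable J -> (\int[mu]_X (\1_J X)%:E = mu J)%E.
  by move=> mJ; rewrite integral_indic//; congr (mu _); exact: setIT.
have intN : (\int[mu]_X (N X)%:E = (\sum_(i < K.*2.+1) (b' i - a' i))%:E)%E.
  under eq_integral do rewrite /N -sumEFin.
  rewrite ge0_integral_sum//; last by move=> i; exact: m1.
  rewrite -sumEFin; apply: eq_bigr => i _; rewrite intI//.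
  by have [_ _ /spans_measure] := sI i.
have int1 : (\int[mu]_X (\1_(`[- D, D]) X)%:E = (2 * D)%:E)%E.
  rewrite intI// /mu lebesgue_measure_itv/= lte_fin.
  case: ltP => DD; last by congr EFin; lra.
  by rewrite -EFinD; congr EFin; ring.
have ue0 : 0 <= `|u| / e by rewrite divr_ge0// ltW.
have intl : (\int[mu]_X (`|u| / e * len X)%:E = (`|u| / e)%:E * area A)%E.
  by rewrite areaE -ge0_integralZl_EFin// => X _; rewrite lee_fin.
have mul : measurable_fun [set: R] (EFin \o (fun X => `|u| / e * len X)).
  by apply/measurable_EFinP; apply: measurable_funM => //; exact/measurable_EFinP.
have ulen0 X : 0 <= `|u| / e * len X by exact: mulr_ge0.
have ind0 X : (0 <= (\1_(`[- D, D]) X : R)%:E)%E by rewrite lee_fin indicE.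
have low : ((`|u| / e)%:E * area A <= (\sum_(i < K.*2.+1) (b' i - a' i) + 2 * D)%:E)%E.
  rewrite -intl EFinD -intN -int1 -ge0_integralD; [|by []|by move=> X _; rewrite lee_fin|
    exact: mN|by move=> X _; exact: ind0|exact: m1].
  apply: ge0_le_integral; [by []|by move=> X _; rewrite lee_fin|exact: mul| |].
    by apply: emeasurable_funD; [exact: mN|exact: m1].
  move=> X _; rewrite -EFinD lee_fin.
  by have := (lenE X).2; rewrite ler_distl => /andP[? ?]; lra.
have up : ((\sum_(i < K.*2.+1) (b' i - a' i))%:E <= (`|u| / e)%:E * area A + (2 * D)%:E)%E.
  rewrite -intl -intN -int1 -ge0_integralD; [|by []|by move=> X _; rewrite lee_fin|
    exact: mul|by move=> X _; exact: ind0|exact: m1].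
  apply: ge0_le_integral; [by []|by move=> X _; rewrite lee_fin|exact: mN| |].
    by apply: emeasurable_funD; [exact: mul|exact: m1].
  move=> X _; rewrite -EFinD lee_fin.
  by have := (lenE X).2; rewrite ler_distl => /andP[? ?]; lra.
have ue : 0 < `|u| / e by rewrite divr_gt0.
have area0 : (0 <= area A)%E by rewrite areaE integral_ge0// => X _; rewrite lee_fin.
have areaf : area A \is a fin_num.
  rewrite ge0_fin_numE// ltey; apply/eqP => areay.
  by move: low; rewrite areay gt0_muley ?lte_fin.
exists (fine (area A)); first by rewrite fineK.
move: low up; rewrite -(fineK areaf) -EFinM -EFinD !lee_fin.
move: (fine (area A)) => al.
rewrite (eq_bigr (fun i : 'I_ _ => (b i - a i) * `|u|)); last by move=> i _; exact: lenI.
rewrite -mulr_suml; move: (\sum_(i < _) _) => B low up.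
have -> : B - al / e = (B * `|u| - `|u| / e * al) / `|u|.
  by field; rewrite !gt_eqF.
rewrite normrM [X in _ * X]ger0_norm ?invr_ge0// ler_pM2r ?invr_gt0// ler_distl.
by apply/andP; split; lra.
Qed.

Lemma measurable_swap_set A : measurable A -> measurable (swap_set A).
Proof.
move=> mA; have := @measurable_swap _ _ R R measurableT A mA.
by rewrite setTI.
Qed.

(** One of [|cos th|] and [|sin th|] is at least [1 / 2], and the chords are
    projected on the corresponding axis.  Exchanging the coordinates is the only
    symmetry of the area that this takes; its invariance under rotations is
    replaced by the choice of the axis. *)
Lemma sum_chords_area A (D e th : R) (K : nat) (a b : nat -> R) :
  measurable A -> segment_closed A -> 0 <= D ->
  (forall p, A p -> `|p.1| <= D /\ `|p.2| <= D) ->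
  0 < e -> 2 * D <= K%:R * e ->
  (forall i : nat, spans (a i) (b i) [set t | A (line_point th (slot K e i) t)]) ->
  exists2 al : R, area A = al%:E &
    `|\sum_(i < K.*2.+1) (b i - a i) - al / e| <= 4 * D.
Proof.
move=> mA cA D0 AD e0 DK sT.
have cs := cos2Dsin2 th.
have half (u : R) : 1 / 2 <= `|u| -> 2 * D / `|u| <= 4 * D.
  move=> u2; rewrite ler_pdivrMr; first by nra.
  by apply: lt_le_trans u2; lra.
have [c2|c2] := leP (1 / 2) `|cos th|.
  have u0 : cos th != 0 by rewrite -normr_gt0; lra.
  have [|al areaE le_al] := @sum_chords_project A D e (cos th) (sin th) 1 K a b
    mA cA D0 AD e0 DK cs (expr1n _ _) u0.
    by move=> i; move: (sT i); congr (spans _ _ _); apply/seteqP; split => t;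
      rewrite /line_point /= !mul1r.
  by exists al => //; apply: (le_trans le_al); exact: half.
have s2 : 1 / 2 <= `|sin th|.
  have := real_normK (num_real (cos th)); have := real_normK (num_real (sin th)).
  have := normr_ge0 (cos th); have := normr_ge0 (sin th).
  rewrite leNgt => ? ? E1 E2; apply/negP => ?; nra.
have u0 : sin th != 0 by rewrite -normr_gt0; lra.
have [|||||al areaE le_al] := @sum_chords_project (swap_set A) D e (sin th) (cos th) (-1) K a b
  (measurable_swap_set mA) _ D0 _ e0 DK _ _ u0.
- by move=> p q l Ap Aq l01; exact: (cA _ _ l Ap Aq l01).
- by move=> p /AD[].
- by rewrite addrC.
- by rewrite sqrrN expr1n.
- move=> i; move: (sT i); congr (spans _ _ _); apply/seteqP; split => t;
    by rewrite /line_point /swap_set /= !mulN1r !mulNr opprK.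
exists al; first by rewrite -area_swap.
by apply: (le_trans le_al); exact: half.
Qed.

End chord_sums.

(** * The Steinhaus set as a finite grid of chords *)

Section lines.
Variable R : realType.
Implicit Types (A : set (R * R)) (p q : R * R) (th x D : R).

Definition chord A th x : set R := [set t | A (line_point th x t)].

Lemma lineI A th x : line th x `&` A = line_point th x @` chord A th x.
Proof.
apply/seteqP; split => [p [[t _ <-] At]|p [t At <-]]; first by exists t.
by split => //; exists t.
Qed.

Lemma offset0_line th x p : offset th x p = 0 <-> line th x p.
Proof.
split=> [ off0|[t _ <-]]; last first.
  rewrite (_ : (_, _) = line_point th x t)// offset_line_point subrr sin0 cos0; ring.
exists (cos th * p.1 + sin th * p.2) => //.
have xE : x = cos th * p.2 - sin th * p.1 by apply/esym/eqP; rewrite -subr_eq0; apply/eqP.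
have := cos2Dsin2 th; rewrite {}xE {off0}; move: (cos th) (sin th) p => c s [y z] /= cs.
by congr pair; [transitivity ((c ^+ 2 + s ^+ 2) * y)|transitivity ((c ^+ 2 + s ^+ 2) * z)];
  (try by rewrite cs mul1r); ring.
Qed.

Lemma rotated_coord_bound D th p : `|p.1| <= D /\ `|p.2| <= D ->
  `|cos th * p.1 + sin th * p.2| <= 2 * D /\
  `|cos th * p.2 - sin th * p.1| <= 2 * D.
Proof.
move=> [p1 p2].
have c1 := cos_max th; have s1 := sin_max th.
have m (c y : R) : `|c| <= 1 -> `|y| <= D -> `|c * y| <= D.
  by move=> c1' yD; rewrite normrM (le_trans _ yD)// ler_piMl.
split.
  rewrite (le_trans (ler_normD _ _))// mulr_natl mulr2n lerD// m//.
rewrite (le_trans (ler_normB _ _))// mulr_natl mulr2n lerD// m//.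
Qed.

Variables (A : set (R * R)) (D : R).
Hypotheses (cA : segment_closed A) (D0 : 0 <= D).
Hypothesis AD : forall p, A p -> `|p.1| <= D /\ `|p.2| <= D.

Lemma chord_spans th x : exists a b,
  [/\ - (2 * D) <= a, b <= 2 * D & spans a b (chord A th x)].
Proof.
apply: is_interval_spans; first by rewrite mulr_ge0.
  have := segment_closed_slice (p := (- sin th * x, cos th * x)) (q := (cos th, sin th)) cA.
  congr is_interval; apply/seteqP; split => t /=;
  by rewrite /chord/line_point/= mulNr (addrC (- _)) (mulrC t) (addrC (cos th * x)) (mulrC t).
move=> t /AD /(rotated_coord_bound th)[+ _].
rewrite /line_point/=; congr (`|_| <= _).
have := cos2Dsin2 th; move: (cos th) (sin th) => c s cs.
by transitivity ((c ^+ 2 + s ^+ 2) * t); [ring|rewrite cs mul1r].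
Qed.

Lemma line_offset_bound th x p : A p -> line th x p -> `|x| <= 2 * D.
Proof.
move=> /AD /(rotated_coord_bound th)[_ +] /offset0_line.
by rewrite /offset => + /eqP; rewrite subr_eq0 => + /eqP <-.
Qed.

Section grid.
Variables (n K : nat) (e : R).
Hypotheses (n0 : (0 < n)%N) (e0 : 0 < e) (DK : 2 * D <= K%:R * e).

Definition grid_index := ('I_n * 'I_(K.*2.+1))%type.
Definition grid_angle (i : grid_index) : R := pi * i.1%:R / n%:R.
Definition grid_shift (i : grid_index) : R := slot K e i.2.

Lemma grid_angle_itv (k : nat) : (k < n)%N -> 0 <= (pi : R) * k%:R / n%:R < pi.
Proof.
move=> kn; have n0R : 0 < n%:R :> R by rewrite ltr0n.
apply/andP; split; first by rewrite !mulr_ge0 ?invr_ge0// pi_ge0.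
by rewrite ltr_pdivrMr// ltr_pM2l ?pi_gt0// ltr_nat.
Qed.

Lemma sin_itv_eq0 (y z : R) : 0 <= y < pi -> 0 <= z < pi -> sin (y - z) = 0 -> y = z.
Proof.
move=> /andP[y0 y1] /andP[z0 z1] yz; case: (ltgtP y z) => // lt_.
  have : 0 < sin (z - y) by apply: sin_gt0_pi; apply/andP; split; lra.
  by rewrite -opprB sinN yz oppr0 ltxx.
have : 0 < sin (y - z) by apply: sin_gt0_pi; apply/andP; split; lra.
by rewrite yz ltxx.
Qed.

Lemma grid_distinct (i j : grid_index) : i != j ->
  sin (grid_angle i - grid_angle j) != 0 \/
  grid_angle i = grid_angle j /\ grid_shift i != grid_shift j.
Proof.
move=> ij; have [ij1|ij1] := eqVneq i.1 j.1.
  right; split; first by rewrite /grid_angle ij1.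
  apply: contra_neq ij; rewrite /grid_shift /slot => /(mulIf (lt0r_neq0 e0))/addIr/eqP.
  rewrite eqr_nat => /eqP/val_inj ij2.
  by rewrite (surjective_pairing i) (surjective_pairing j) ij1 ij2.
left; apply: contra_neq ij1 => /sin_itv_eq0 E.
have := E (grid_angle_itv (ltn_ord _)) (grid_angle_itv (ltn_ord _)).
have n0R : n%:R != 0 :> R by rewrite pnatr_eq0 -lt0n.
move=> /(mulIf (invr_neq0 n0R))/(mulfI (lt0r_neq0 (pi_gt0 R)))/eqP.
by rewrite eqr_nat => /eqP/val_inj.
Qed.

Lemma steinhaus_grid p : A p -> steinhaus n e p ->
  exists i : grid_index, line (grid_angle i) (grid_shift i) p.
Proof.
move=> Ap [k [s [kn lp]]].
have := le_trans (line_offset_bound Ap lp) DK.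
rewrite normrM (gtr0_norm e0) ler_pM2r// => sK.
have [j jK sj] : exists2 j : nat, (j < K.*2.+1)%N & s%:~R = j%:R - K%:R :> R.
  move: sK; rewrite (_ : K%:R = (Posz K)%:~R :> R) // -intr_norm ler_int => sK.
  exists (absz (s + K)); first lia.
  rewrite (_ : _%:R = (Posz `|s + K|)%:~R)// -intrB; congr (_%:~R); lia.
by exists (Ordinal kn, Ordinal jK); rewrite /grid_shift /slot -sj.
Qed.

Lemma grid_steinhaus p (i : grid_index) :
  line (grid_angle i) (grid_shift i) p -> steinhaus n e p.
Proof.
move=> lp; exists i.1, (Posz i.2 - Posz K); split=> //.
by rewrite intrB.
Qed.

Lemma steinhausE : A `&` steinhaus n e =
  \bigcup_i (line_point (grid_angle i) (grid_shift i) @`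
    chord A (grid_angle i) (grid_shift i)).
Proof.
apply/seteqP; split => [p [Ap /(steinhaus_grid Ap)[i lp]]|p [i _]].
  by exists i => //; rewrite -lineI.
by rewrite -lineI => -[lp Ap]; split => //; exact: grid_steinhaus lp.
Qed.

(** The constant [D] bounds the coordinates of the points of [A], hence [2 * D]
    bounds the offsets of the lines that meet [A], and the grid with
    [2 * D <= K * e] contains all the lines that matter. *)
Lemma hausdorff1_steinhaus : measurable A ->
  exists al H : R, [/\ area A = al%:E, hausdorff1 (A `&` steinhaus n e) = H%:E &
    `|H - n%:R * (al / e)| <= n%:R * (4 * D)].
Proof.
move=> mA.
have /choice[a /choice[b ab]] k : exists a, exists b : nat -> R, forall j,
    spans (a j) (b j) (chord A (pi * k%:R / n%:R) (slot K e j)).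
  have /choice[a /choice[b ab]] j := chord_spans (pi * k%:R / n%:R) (slot K e j).
  by exists a, b => j; case: (ab j).
have al_ex k := sum_chords_area mA cA D0 AD e0 DK (ab k).
have [al areaE _] := al_ex 0%N.
exists al, (\sum_(i : grid_index) (b i.1 i.2 - a i.1 i.2)); split => //.
  rewrite steinhausE.
  apply: (@hausdorff1_chords R ('I_n * 'I_(K.*2.+1))%type grid_angle grid_shift
    (fun i => chord A (grid_angle i) (grid_shift i))
    (fun i => a i.1 i.2) (fun i => b i.1 i.2)).
    by move=> i; exact: ab.
  exact: grid_distinct.
have -> : n%:R * (al / e) = \sum_(k < n) (al / e) by rewrite sumr_const card_ord mulr_natl.
rewrite -(pair_big xpredT xpredT (fun (k : 'I_n) (j : 'I_(K.*2.+1)) => b k j - a k j))/=.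
rewrite -sumrB (le_trans (ler_norm_sum _ _ _))//.
have -> : n%:R * (4 * D) = \sum_(k < n) (4 * D) by rewrite sumr_const card_ord mulr_natl.
apply: ler_sum => k _; have [al' + le_al] := al_ex k.
by rewrite areaE => -[->].
Qed.

(** The line meets the line of direction [k] and offset [y] at the parameter
    [cross k y], which is affine in [y] with slope [1 / sin].  So the crossed
    lines of direction [k] correspond to grid points in the inverse image [J k]
    of the chord, an interval of length [(b - a) * |sin|].  Since no two lines
    of the grid are crossed at the same point, counting points of the
    intersection amounts to counting crossed lines. *)
Lemma crossing_count th x (a b : R) :
  (forall k : nat, (k < n)%N -> sin (th - pi * k%:R / n%:R) != 0) ->
  (forall (i j : grid_index) p, line th x p ->
     line (grid_angle i) (grid_shift i) p ->
     line (grid_angle j) (grid_shift j) p -> i = j) ->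
  spans a b (chord A th x) ->
  exists N : R, counting (line th x `&` (A `&` steinhaus n e)) = N%:E /\
  `|N - (b - a) / e * \sum_(k < n) `|sin (th - pi * k%:R / n%:R)| | <= n%:R.
Proof.
move=> s0 simple sT.
pose si (k : nat) := sin (th - pi * k%:R / n%:R).
pose ci (k : nat) := cos (th - pi * k%:R / n%:R).
pose cross (k : nat) (y : R) := (si k)^-1 * y + - (ci k * x / si k).
have crossP (k : nat) y t : (k < n)%N ->
    line (pi * k%:R / n%:R) y (line_point th x t) <-> t = cross k y.
  move=> kn; have := s0 k kn; rewrite -/(si k) => sk.
  apply: (iff_trans (iff_sym (offset0_line _ _ _))).
  rewrite offset_line_point -/(si k) -/(ci k) /cross; split => [E|->]; last by field.
  have -> : y = si k * t + ci k * x by apply/esym/eqP; rewrite -subr_eq0 -addrA E.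
  by field.
pose J (k : nat) := [set y | chord A th x (cross k y)].
pose P := [set i : grid_index | `[< J i.1 (grid_shift i) >]]%SET.
pose pt (i : grid_index) := line_point th x (cross i.1 (grid_shift i)).
have ptP i : i \in P -> A (pt i) by rewrite inE => /asboolP.
have pt_line i : line (grid_angle i) (grid_shift i) (pt i).
  by apply/crossP.
have cntE : line th x `&` (A `&` steinhaus n e) = [set` [fset pt i | i in P]%fset].
  apply/seteqP; split => [p [lp [Ap /(steinhaus_grid Ap)[i ip]]]|p /=].
    move: (lp) => [t _ tp]; apply/imfsetP; exists i => /=.
      rewrite inE; apply/asboolP; rewrite /J /= /chord /=.
      by rewrite -(iffLR (crossP _ _ t (ltn_ord i.1)) _)// /line_point tp.
    by rewrite /pt -(iffLR (crossP _ _ t (ltn_ord i.1)) _) /line_point tp.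
  move=> /imfsetP[i /= iP ->]; split; first by exists (cross i.1 (grid_shift i)).
  by split; [exact: ptP|exact: grid_steinhaus (pt_line i)].
have cardE : counting (line th x `&` (A `&` steinhaus n e)) = #|P|%:R%:E :> \bar R.
  rewrite /counting asboolT; last by rewrite cntE; exact: finite_fset.
  rewrite cntE set_fsetK card_in_imfset/=; first by rewrite -cardE.
  move=> i j iP jP /= ij; apply: (simple i j (pt i)); last by rewrite ij.
    by exists (cross i.1 (grid_shift i)).
  exact: pt_line.
exists #|P|%:R; split => //.
have -> : #|P|%:R = \sum_(k < n) \sum_(j < K.*2.+1) \1_(J k) (slot K e j) :> R.
  rewrite (pair_big xpredT xpredT
    (fun (k : 'I_n) (j : 'I_(K.*2.+1)) => \1_(J k) (slot K e j)))/=.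
  rewrite -sum1_card natr_sum big_mkcond/=; apply: eq_bigr => i _.
  rewrite indicE inE; case: ifPn => [/asboolP JP|/asboolPn JP]; first by rewrite mem_set.
  by rewrite memNset.
rewrite mulr_sumr -sumrB (le_trans (ler_norm_sum _ _ _))//.
rewrite [leRHS](_ : _ = \sum_(k < n) 1); last by rewrite sumr_const card_ord.
apply: ler_sum => k _; rewrite -/(si k).
have sk : si k != 0 by exact: s0.
have [a1 [b1 [sJ ab1]]] := spans_affine (- (ci k * x / si k)) (invr_neq0 sk) sT.
rewrite -[X in spans _ _ X]/(J k) in sJ.
have JD y : J k y -> `|y| <= 2 * D.
  by move=> Jy; apply: (line_offset_bound (th := pi * k%:R / n%:R) Jy); apply/crossP.
have [|a2 [b2 [a2D b2D sJ2]]] := is_interval_spans _ (spans_is_interval sJ) JD.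
  by rewrite mulr_ge0.
have := spans_count e0 sJ2 a2D b2D DK.
have -> : b2 - a2 = b1 - a1.
  by have := spans_measure sJ2; rewrite (spans_measure sJ) => -[].
by rewrite ab1 normfV invrK -mulrA (mulrC `|_|) mulrA.
Qed.

End grid.
End lines.

(** * Exceptional lines *)

Section negligible_lines.
Variable R : realType.
Implicit Types (p q : R * R) (th x : R).

(** The bundled form of [kinematic], from which the filter of almost all lines
    gets its instance. *)
Definition kinematic_measure := [the {measure set _ -> \bar R} of @kinematic R].

#[global] Instance ae_kinematic_filter :
  Filter (nbhs (almost_everywhere kinematic_measure)) :=
  ae_filter_ringOfSetsType kinematic_measure.

Lemma kinematic_X (B : set R) : measurable B ->
  lebesgue_measure (B `&` `[0%R, pi[) = 0%E -> kinematic_measure (B `*` [set: R]) = 0%E.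
Proof.
move=> mB B0.
pose mu0 := mrestr (@lebesgue_measure R) (measurable_itv `[0, pi[).
transitivity (mu0 B * @lebesgue_measure R setT)%E.
  exact: (@product_measure1E _ _ _ _ R [the {measure set _ -> \bar R} of mu0]
    (@lebesgue_measure R) B setT mB measurableT).
by rewrite (_ : mu0 B = 0%E) ?mul0e.
Qed.

Lemma ae_angle_neq (c : R) : \forall l \ae kinematic_measure, l.1 != c.
Proof.
exists ([set c] `*` [set: R]); split.
- by apply: measurableX.
- apply: kinematic_X => //; have [cI|cI] := boolP (c \in `[0, pi[).
    rewrite (_ : _ `&` _ = [set c]) ?lebesgue_measure_set1//.
    by apply/setIidPl => y ->.
  rewrite (_ : _ `&` _ = set0) ?measure0//.
  by apply/seteqP; split => // y [-> /=]; apply/negP.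
- by move=> [th x] /= /negP; rewrite negbK => /eqP ->.
Qed.

Lemma ae_angle_itv : \forall l \ae kinematic_measure, 0 <= l.1 < pi.
Proof.
exists (~` `[0, pi[%classic `*` [set: R]); split.
- by apply: measurableX => //; exact: measurableC.
- by apply: kinematic_X => //; [exact: measurableC|rewrite setICl measure0].
- by move=> [th x] /= nl; split=> //; rewrite in_itv.
Qed.

(** For every angle exactly one value of [x] gives a line through [q], so these
    lines form the graph of a continuous function of the angle. *)
Lemma ae_line_avoids q : \forall l \ae kinematic_measure, ~ line l.1 l.2 q.
Proof.
pose f (l : R * R) := l.2 - (cos l.1 * q.2 - sin l.1 * q.1).
have mf : measurable_fun setT f.
  have mc : measurable_fun [set: R * R] (fun l => cos l.1).
    by apply: measurableT_comp => //; exact: continuous_measurable_fun (@continuous_cos R).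
  have ms : measurable_fun [set: R * R] (fun l => sin l.1).
    by apply: measurableT_comp => //; exact: continuous_measurable_fun (@continuous_sin R).
  apply: measurable_funB => //; apply: measurable_funB; apply: measurable_funM => //.
exists (f @^-1` [set 0]); split.
- by rewrite -[X in measurable X]setTI; exact: mf.
- rewrite /kinematic_measure /kinematic; apply: integral0_eq => th _ /=.
  rewrite (_ : xsection _ _ = [set cos th * q.2 - sin th * q.1]).
    by rewrite lebesgue_measure_set1.
  apply/seteqP; split => x; rewrite /xsection /=.
    by move=> /set_mem; rewrite /f /= => /eqP; rewrite subr_eq0 => /eqP.
  by move=> xE; apply/mem_set; rewrite /f /= xE subrr.
- move=> [th x] /= /contrapT /offset0_line; rewrite /offset /f/= => E.
  by apply/eqP; rewrite -oppr_eq0 opprB E.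
Qed.

Lemma line_meet_unique th x th' x' p q : sin (th - th') != 0 ->
  line th x p -> line th' x' p -> line th x q -> line th' x' q -> p = q.
Proof.
move=> s0 /offset0_line E1 /offset0_line E2 /offset0_line E3 /offset0_line E4.
have cramer r : offset th x r = 0 -> offset th' x' r = 0 ->
    sin (th - th') * r.1 = cos th * x' - cos th' * x /\
    sin (th - th') * r.2 = sin th * x' - sin th' * x.
  rewrite /offset => /eqP; rewrite subr_eq0 => /eqP <- /eqP.
  by rewrite subr_eq0 => /eqP <-; rewrite sinB; split; ring.
have [p1 p2] := cramer p E1 E2; have [q1 q2] := cramer q E3 E4.
rewrite (surjective_pairing p) (surjective_pairing q).
by congr pair; apply: (mulfI s0); rewrite ?p1 ?p2 ?q1 ?q2.
Qed.

Lemma ae_line_misses_meet th x th' x' : sin (th - th') != 0 ->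
  \forall l \ae kinematic_measure, forall p, line l.1 l.2 p ->
    line th x p -> ~ line th' x' p.
Proof.
move=> s0.
have [[q [q1 q2]]|no] := pselect (exists q, line th x q /\ line th' x' q).
  apply: filterS (ae_line_avoids q) => l nlq p lp p1 p2; apply: nlq.
  by rewrite (line_meet_unique s0 q1 q2 p1 p2).
by apply: nearW => l p _ p1 p2; apply: no; exists p.
Qed.

End negligible_lines.

(** * The uniform bound *)

Section steinhaus_bounds.
Variable R : realType.
Implicit Types A : set (R * R).

Lemma Linfty_lines_le (f : set (R * R) -> \bar R) (C : R) : 0 <= C ->
  (\forall l \ae kinematic_measure R, (`|f (line l.1 l.2)| <= C%:E)%E) ->
  (Linfty_lines f <= C%:E)%E.
Proof.
move=> C0 aeC; rewrite /Linfty_lines Lnorm.unlock; case: ifP => _; last by rewrite lee_fin.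
by apply/ess_sup_inf.ess_supP.
Qed.

Lemma open_area_gt0 A : open A -> A !=set0 -> (0 < area A)%E.
Proof.
move=> oA [[x y] Axy].
have [/= r r0 rA] : exists2 r : R, 0 < r & ball (x, y) r `<=` A.
  by move: oA; rewrite openE => /(_ _ Axy) /nbhs_ballP[e /= e0 eA]; exists e.
pose B : set (R * R) := `]x - r, x + r[%classic `*` `]y - r, y + r[%classic.
have mB : measurable B by apply: measurableX.
have BA : B `<=` A.
  move=> [x' y'] [] /=; rewrite !in_itv/= => /andP[x1 x2] /andP[y1 y2].
  by apply: rA; split; rewrite /ball/= ltr_norml; apply/andP; split; lra.
have li (z : R) : lebesgue_measure (`]z - r, z + r[ : set R) = (2 * r)%:E.
  rewrite lebesgue_measure_itv/= lte_fin ifT; last by lra.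
  by rewrite -EFinD; congr EFin; ring.
have aB : area B = ((2 * r) * (2 * r))%:E.
  rewrite EFinM -{1}(li x) -(li y).
  exact: (@product_measure1E _ _ _ _ R (@lebesgue_measure R) (@lebesgue_measure R)).
apply: (@lt_le_trans _ _ (area B)).
  by rewrite aB lte_fin; nra.
have mA := open_measurable_plane oA.
exact: (@le_measure _ _ _
  [the measure _ _ of (@lebesgue_measure R \x @lebesgue_measure R)%E]
  _ _ (mem_set mB) (mem_set mA)).
Qed.

Variables (A : set (R * R)) (D : R).
Hypotheses (cA : segment_closed A) (D0 : 0 <= D).
Hypothesis AD : forall p, A p -> `|p.1| <= D /\ `|p.2| <= D.
Variables (n : nat) (e : R).
Hypotheses (n1 : (1 < n)%N) (e0 : 0 < e).

(** The three parts of the bound: the error [n] of [crossing_count]; the error of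
    the sum of sines, multiplied by [(b - a) / e]; and the difference between
    [k] and the density [2 / pi * n / e], multiplied by [b - a].  Chords have
    length at most [4 * D]. *)
Lemma crossing_ae (k : R) : \forall l \ae kinematic_measure R,
  (`|counting (line l.1 l.2 `&` (A `&` steinhaus n e))
     - k%:E * hausdorff1 (line l.1 l.2 `&` A)| <=
   (n%:R + 4 * D * (2 / (n%:R * e) + `|2 / pi * n%:R / e - k|))%:E)%E.
Proof.
have n0 : (0 < n)%N := ltnW n1.
pose K := (Num.truncn (2 * D / e)).+1.
have DK : 2 * D <= K%:R * e by rewrite -ler_pdivrMr// ltW// truncnS_gt.
have ae_itv := @ae_angle_itv R.
have ae_neq : \forall l \ae kinematic_measure R,
    forall i : 'I_n, l.1 != pi * i%:R / n%:R.
  by apply: filter_forall => i; exact: ae_angle_neq.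
have ae_simple : \forall l \ae kinematic_measure R,
    forall ij : grid_index n K * grid_index n K, ij.1 != ij.2 ->
    forall p, line l.1 l.2 p -> line (grid_angle R ij.1) (grid_shift e ij.1) p ->
    ~ line (grid_angle R ij.2) (grid_shift e ij.2) p.
  apply: (@filter_forall _ (('I_n * 'I_(K.*2.+1)) * ('I_n * 'I_(K.*2.+1)))%type).
  move=> [i j] /=; have [->|ij] := eqVneq i j; first by apply: nearW.
  have [sij|[aij sij]] := @grid_distinct R n K e n0 e0 i j ij.
    by apply: filterS (ae_line_misses_meet (grid_shift e i) (grid_shift e j) sij) => l Hl _.
  apply: nearW => l _ p _ /offset0_line + /offset0_line.
  by rewrite aij /offset => /eqP; rewrite subr_eq0 => /eqP -> /eqP;
    rewrite subr_eq0; exact/negP.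
near=> l.
have l_itv : 0 <= l.1 < pi by near: l.
have l_neq : forall i : 'I_n, l.1 != pi * i%:R / n%:R by near: l.
have l_simple : forall ij : grid_index n K * grid_index n K, ij.1 != ij.2 ->
    forall p, line l.1 l.2 p -> line (grid_angle R ij.1) (grid_shift e ij.1) p ->
    ~ line (grid_angle R ij.2) (grid_shift e ij.2) p by near: l.
have [a [b [aD bD sT]]] := chord_spans cA D0 AD l.1 l.2.
have [||N [NE Nle]] := crossing_count D0 AD n0 e0 DK _ _ sT.
- move=> k' kn; apply: contra (l_neq (Ordinal kn)) => /eqP /sin_itv_eq0 E.
  by apply/eqP; apply: E => //; exact: grid_angle_itv.
- move=> i j p lp ip jp; apply/eqP; apply/negPn/negP => ij.
  exact: (l_simple (i, j) ij p lp ip jp).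
rewrite NE lineI (hausdorff1_chord _ _ sT) -EFinM -EFinB lee_fin.
have := sum_abs_sin_approx n1 l_itv.
move: Nle; set S := \sum_(k < n) _; move=> Nle Sle.
have [ab _ _] := sT.
have en : n%:R != 0 :> R by rewrite pnatr_eq0 -lt0n.
have -> : N - k * (b - a) = (N - (b - a) / e * S) +
    (b - a) * (e^-1 * (S - 2 / pi * n%:R) + (2 / pi * n%:R / e - k)) by ring.
rewrite (le_trans (ler_normD _ _))// lerD// normrM.
rewrite ler_pM//; first by rewrite ger0_norm; lra.
rewrite (le_trans (ler_normD _ _))// lerD// normrM gtr0_norm ?invr_gt0//.
by rewrite mulrC invfM mulrA ler_pM2r ?invr_gt0.
Unshelve. all: by end_near. Qed.

Lemma Linfty_crossing (k C : R) :
  n%:R + 4 * D * (2 / (n%:R * e) + `|2 / pi * n%:R / e - k|) <= C ->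
  (Linfty_lines (fun l => counting (l `&` (A `&` steinhaus n e))
     - k%:E * hausdorff1 (l `&` A)) <= C%:E)%E.
Proof.
move=> leC; apply: Linfty_lines_le.
  apply: le_trans leC; rewrite addr_ge0// mulr_ge0 ?mulr_ge0//.
  by rewrite addr_ge0// divr_ge0// mulr_ge0// ltW.
apply: filterS (crossing_ae k) => l /le_trans; apply.
by rewrite lee_fin.
Qed.

End steinhaus_bounds.

(** * Choice of the constants *)

Lemma cube_root_powers (R : realType) (L : R) : 0 < L ->
  (L `^ 3^-1) ^+ 3 = L /\ L `^ (- (2 / 3)) = (L `^ 3^-1) ^- 2.
Proof.
move=> L0; have r0 := powR_ge0 L 3^-1; split.
  by rewrite -powR_mulrn// -powRrM mulVf// powRr1// ltW.
by rewrite powRN -powR_mulrn// -powRrM (mulrC 3^-1).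
Qed.

(** In this lemma and the next one [y] stands for the cube root of [L], [m] for
    the number of directions, [al] for the area and [y ^- 2] for the spacing. *)
Lemma length_arith (R : realType) (al D y m H : R) : 0 < al -> 0 <= D ->
  1 <= y -> 8 * D <= al * y -> y / 2 <= m <= 2 * y ->
  `|H - m * (al * y ^+ 2)| <= m * (4 * D) ->
  al / 4 * y ^+ 3 <= H <= (2 * al + 8 * D) * y ^+ 3.
Proof.
move=> al0 D0 y1 Dy /andP[m1 m2]; rewrite ler_distl => /andP[H1 H2].
have y2 : y <= y ^+ 2 by rewrite expr2 ler_peMl//; lra.
have aly : 8 * D <= al * y ^+ 2.
  by apply: (le_trans Dy); rewrite ler_pM2l.
have y3 : y ^+ 3 = y * y ^+ 2 by rewrite exprS.
have y23 : y <= y ^+ 3 by rewrite y3 ler_peMr//; lra.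
apply/andP; split.
- apply: le_trans H1; rewrite -mulrBr.
  apply: (@le_trans _ _ (y / 2 * (al * y ^+ 2 - 4 * D))); last first.
    by rewrite ler_wpM2r//; lra.
  rewrite (_ : al / 4 * y ^+ 3 = y / 2 * (al * y ^+ 2 / 2)); last by rewrite y3; field.
  by rewrite ler_wpM2l//; lra.
- apply: (le_trans H2); rewrite -mulrDr.
  apply: (@le_trans _ _ (2 * y * (al * y ^+ 2 + 4 * D))).
    by rewrite ler_wpM2r//; lra.
  rewrite (_ : 2 * y * _ = 2 * al * y ^+ 3 + 8 * D * y); last by rewrite y3; ring.
  by rewrite [leRHS]mulrDl lerD2l ler_wpM2l//; lra.
Qed.

Lemma error_arith (R : realType) (al D y m d : R) : 0 < al -> 0 <= D ->
  1 <= y -> y / 2 <= m <= 2 * y -> d <= m * (4 * D) / al ->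
  m + 4 * D * (2 / (m * y ^- 2) + d) <= (2 + 16 * D + 32 * D ^+ 2 / al) * y.
Proof.
move=> al0 D0 y1 /andP[m1 m2] dm.
have y0 : 0 < y by lra.
have m0 : 0 < m by lra.
have h1 : 2 / (m * y ^- 2) <= 4 * y.
  rewrite (_ : 2 / (m * y ^- 2) = 2 * y ^+ 2 / m); last by field; rewrite !gt_eqF.
  by rewrite ler_pdivrMr// expr2; nra.
have h2 : d <= 8 * D * y / al.
  by apply: (le_trans dm); rewrite ler_pM2r ?invr_gt0//; nra.
have -> : (2 + 16 * D + 32 * D ^+ 2 / al) * y =
    2 * y + 4 * D * (4 * y + 8 * D * y / al) by ring.
by rewrite lerD// ler_wpM2l ?mulr_ge0// lerD.
Qed.

Theorem theorem2 (R : realType) (Omega : set (R * R))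
    (Omega_open : open Omega) (Omega_neq0 : Omega !=set0)
    (Omega_bounded : bounded_set (Omega : set (R^o * R^o)))
    (Omega_convex : convex_set (Omega : set (R^o * R^o))) :
  exists c a b : R, [/\ 0 < c, 0 < a, 0 < b &
    \forall L \near +oo, forall n : nat, `|n%:R - L `^ 3^-1| < 1 ->
      let S := Omega `&` steinhaus n (L `^ (- (2 / 3))) in
      [/\ ((a * L)%:E <= hausdorff1 S <= (b * L)%:E)%E,
          (Linfty_lines (fun l => counting (l `&` S)
             - (2 / pi)%:E * (hausdorff1 S / area Omega)
               * hausdorff1 (l `&` Omega))
           <= (c * L `^ 3^-1)%:E)%E
        & area Omega = 1%E -> n%:R = L `^ 3^-1 ->
          (Linfty_lines (fun l => counting (l `&` S)
             - (2 / pi)%:E * (L%:E / area Omega)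
               * hausdorff1 (l `&` Omega))
           <= (c * L `^ 3^-1)%:E)%E]].
Proof.
have mO := open_measurable_plane Omega_open.
have cO := convex_set_segment_closed Omega_convex.
have [D Dpos OD] := bounded_plane Omega_bounded.
have D0 := ltW Dpos.
have grid_size (e : R) : 0 < e -> 2 * D <= (Num.truncn (2 * D / e)).+1%:R * e.
  by move=> e0; rewrite -ler_pdivrMr// ltW// truncnS_gt.
(* The estimate of the length for one direction and spacing 1 also provides the
   finiteness of the area. *)
have [al [_ [areaE _ _]]] :=
  hausdorff1_steinhaus cO D0 OD (ltn0Sn 0) ltr01 (grid_size 1 ltr01) mO.
have al0 : 0 < al by have := open_area_gt0 Omega_open Omega_neq0; rewrite areaE.
have c0 : 0 < 2 + 16 * D + 32 * D ^+ 2 / al.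
  by rewrite !addr_gt0// ?divr_gt0 ?mulr_gt0 ?exprn_gt0.
exists (2 + 16 * D + 32 * D ^+ 2 / al), (al / 4), (2 * al + 8 * D).
split=> //; first by rewrite divr_gt0.
  by rewrite addr_gt0// mulr_gt0.
(* The bound [M <= y] on the cube root [y] of [L] ensures [1 < n] and
   [8 * D <= al * y]. *)
pose M := 3 + 8 * D / al.
have M3 : 3 <= M by rewrite lerDl divr_ge0// ?mulr_ge0// ltW.
exists (M ^+ 3); split; first exact: num_real.
move=> L ML n nL /=.
have L0 : 0 < L by apply: lt_trans ML; rewrite exprn_gt0//; lra.
have [yL eE] := cube_root_powers L0; rewrite eE.
move: nL yL; set y := L `^ 3^-1 => nL yL.
have yM : M <= y.
  rewrite -(@ler_pXn2r _ 3)// ?nnegrE ?yL ?ltW//; last exact: powR_gt0.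
  by lra.
have y0 : 0 < y by lra.
have e0 : 0 < y ^- 2 by rewrite invr_gt0 exprn_gt0.
have /andP[nl nu] : y - 1 < n%:R < y + 1 by move: nL; rewrite ltr_distl.
have n1 : (1 < n)%N by rewrite -(ltr_nat R); lra.
have n0 : (0 < n)%N := ltnW n1.
have ny : y / 2 <= n%:R <= 2 * y by apply/andP; split; lra.
have y1 : 1 <= y by lra.
have Dy : 8 * D <= al * y.
  apply: (@le_trans _ _ (al * M)); last by rewrite ler_pM2l.
  have -> : al * M = 3 * al + 8 * D by rewrite /M; field; rewrite gt_eqF.
  by lra.
have [al' [H [areaE' HE Hle]]] :=
  hausdorff1_steinhaus cO D0 OD n0 e0 (grid_size _ e0) mO.
move: areaE'; rewrite areaE => -[alE]; move: Hle; rewrite -{al'}alE => Hle.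
rewrite HE inver gt_eqF//.
have pi0 : 0 < pi :> R := pi_gt0 R.
have pi2 : 2 / pi <= 1 :> R by rewrite ler_pdivrMr// mul1r pi_ge2.
split.
- rewrite !lee_fin -yL; apply: (length_arith al0 D0 y1 Dy ny).
  by move: Hle; rewrite invrK.
- rewrite -!EFinM; apply: (Linfty_crossing cO D0 OD n1 e0).
  apply: error_arith => //.
  rewrite (_ : _ - _ = 2 / pi * (- (H - n%:R * (al / y ^- 2)) / al)); last first.
    have aln : al != 0 by rewrite gt_eqF.
    by rewrite !invrK; move: (2 / pi) => ?; field.
  rewrite normrM ger0_norm; last by rewrite divr_ge0// ltW.
  rewrite (le_trans (ler_piMl _ pi2))// normrM normrN normfV (gtr0_norm al0).
  by rewrite ler_pM2r ?invr_gt0.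
- move=> [al1] nyE; rewrite -!EFinM; apply: (Linfty_crossing cO D0 OD n1 e0).
  apply: error_arith => //.
  rewrite (_ : _ - _ = 0); last by rewrite nyE -yL al1 invrK invr1; ring.
  by rewrite normr0 divr_ge0 ?mulr_ge0// ltW.
Qed.
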